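(* Let $N\in\mathbb{N}$, $m_i\in(0,\infty)$ and $a_i,b_i\in[0,\infty)$ for all $i\in[N]$, and let $X=(X(t))_{t\ge 0}$ be the elastic particle system with these parameters started from a deterministic, arbitrary $X(0)\in\mathbb{X}_N$. Suppose that $$\frac{U_k}{M_k}<\frac{U_N}{M_N},\quad\text{for all } k\in[N-1]. \qquad (\ast)$$ Then the system is a single stable cloud in the following sense. (a) (Limiting speed.) For every $i\in[N]$, $\lim_{t\to\infty} t^{-1}X_i(t) = -\dfrac{U_N}{M_N}$, a.s. (b) (Relative stability.) There exist constants $C\in[0,\infty)$ and $\delta>0$ (depending on the $a_i$, $b_i$ and $m_i$) such that $$\sup_{t\ge 0}\mathbb{P}\left[\Delta_{[N]}(t)\ge s\right]\le C\left[1+e^{C\Delta_{[N]}(0)}\right]e^{-\delta s},\quad\text{for all } s\ge 0,$$ and, moreover, $\limsup_{t\to\infty}\dfrac{\Delta_{[N]}(t)}{\log t}<\infty$, a.s. Furthermore, condition $(\ast)$ is necessary for (b) to hold.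
   Context: Notation: $[n]=\{1,2,\dots,n\}$, $\mathbb{N}=\{1,2,\dots\}$. The configuration space is $\mathbb{X}_N=\{(x_i)_{i\in[N]}\in\mathbb{Z}^N: x_1\le\cdots\le x_N\}$. Elastic particle system: the continuous-time Markov chain $X(t)=(X_i(t))_{i\in[N]}$ on $\mathbb{X}_N$ in which, for each $i\in[N]$, coordinate $X_i(t)$ jumps to $X_i(t)-1$ at rate $A_i(X(t))$ and to $X_i(t)+1$ at rate $B_i(X(t))$, where for $x\in\mathbb{X}_N$ $$A_i(x)=\mathbf{1}\{x_{i-1}<x_i\}\sum_{j=i}^N\frac{m_ja_j}{m_i}\mathbf{1}\{x_j=x_i\},\qquad B_i(x)=\mathbf{1}\{x_{i+1}>x_i\}\sum_{j=1}^i\frac{m_jb_j}{m_i}\mathbf{1}\{x_j=x_i\},$$ with conventions $x_0=-\infty$, $x_{N+1}=+\infty$. Set $u_i=b_i-a_i$, and $U_k=-\sum_{i=1}^k m_iu_i$, $M_k=\sum_{i=1}^k m_i$ for $k\in[N]$. The span of the system is $\Delta_{[N]}(t)=X_N(t)-X_1(t)$.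
   Formalization: The necessity of (∗) for (b) is proved under the extra assumption that some a_i or b_i is nonzero; if all vanish and N ≥ 2 the system never moves, so (b) holds while (∗) reads 0 < 0 and fails. *)

(* Defs.v *)
From HB Require Import structures.
From mathcomp Require Import all_boot all_order all_algebra.
From mathcomp Require Import all_classical all_reals all_analysis.
Import Order.TTheory GRing.Theory Num.Theory.
Import numFieldNormedType.Exports.

Set Implicit Arguments.
Unset Strict Implicit.
Unset Printing Implicit Defensive.

Local Open Scope classical_set_scope.
Local Open Scope ring_scope.

(* The number of particles is N = n.+1, so that N >= 1 and both the leftmost
   particle [ord0] and the rightmost one [ord_max] exist.  Particle indices run
   over 'I_n.+1, i.e. they are shifted down by one from [N] = {1, ..., N}. *)

Definition ordered_config (n : nat) (x : {ffun 'I_n.+1 -> int}) : bool :=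
  [forall i : 'I_n.+1, forall j : 'I_n.+1, (i <= j)%N ==> (x i <= x j)].

Record config (n : nat) := Config {
  positions :> {ffun 'I_n.+1 -> int};
  positions_ordered : ordered_config positions }.

HB.instance Definition _ n := [isSub for @positions n].
HB.instance Definition _ n := [Countable of config n by <:].

Section Rates.
Context {R : realType} {n : nat}.
Implicit Types (m a b : 'I_n.+1 -> R) (x y : config n) (i j k : 'I_n.+1).

(* The quantifications over the neighbour j of i below are vacuous for i the
   first, resp. the last, particle: this is the convention x_0 = -oo,
   x_{N+1} = +oo. *)
Definition left_free x i : bool :=
  [forall j : 'I_n.+1, (j.+1 == i)%N ==> (x j < x i)].

Definition right_free x i : bool :=
  [forall j : 'I_n.+1, (j == i.+1 :> nat) ==> (x i < x j)].

Definition rateA m a x i : R :=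
  (left_free x i)%:R *
  \sum_(j < n.+1 | (i <= j)%N) m j * a j / m i * (x j == x i)%:R.

Definition rateB m b x i : R :=
  (right_free x i)%:R *
  \sum_(j < n.+1 | (j <= i)%N) m j * b j / m i * (x j == x i)%:R.

Definition shift_particle x i (d : int) : {ffun 'I_n.+1 -> int} :=
  [ffun j => x j + (if j == i then d else 0)].

Definition jump_rate m a b x y : R :=
  \sum_(i < n.+1) (rateA m a x i * (positions y == shift_particle x i (-1))%:R
                   + rateB m b x i * (positions y == shift_particle x i 1)%:R).

(* Diagonal entries are minus the total jump rate: every shifted configuration
   that has a positive rate is again ordered, so rows sum to zero. *)
Definition Qmatrix m a b x y : R :=
  jump_rate m a b x y
  - (x == y)%:R * \sum_(i < n.+1) (rateA m a x i + rateB m b x i).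

Definition Usum m a b k : R :=
  - \sum_(i < n.+1 | (i <= k)%N) m i * (b i - a i).

Definition Msum m k : R := \sum_(i < n.+1 | (i <= k)%N) m i.

(* With the index shift, k ranges over {1, ..., N-1} iff (k < n)%N here. *)
Definition cloud_condition m a b : Prop :=
  forall k, (k < n)%N ->
    Usum m a b k / Msum m k < Usum m a b ord_max / Msum m ord_max.

Definition config_span x : int := x ord_max - x ord0.

End Rates.

Section MarkovChain.
Context {R : realType} {T : countType}.
Implicit Types (p : R -> T -> T -> R) (q : T -> T -> R).

Record transition_function p : Prop := {
  tf_ge0 : forall t x y, 0 <= t -> 0 <= p t x y;
  tf_sum1 : forall t x, 0 <= t -> (\esum_(y in setT) (p t x y)%:E = 1)%E;
  tf_id : forall x y, p 0 x y = (x == y)%:R;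
  tf_semigroup : forall s t x z, 0 <= s -> 0 <= t ->
    (\esum_(y in setT) (p s x y * p t y z)%:E = (p (s + t) x z)%:E)%E }.

Definition has_rates p q : Prop :=
  forall x y, (p h x y - (x == y)%:R) / h @[h --> 0^'+] --> q x y.

(* Probability of going from x at time s through the states prescribed at the
   successive times of l, a list of pairs (time, state). *)
Fixpoint path_prob p (s : R) (x : T) (l : seq (R * T)) : R :=
  if l is (t, y) :: l' then p (t - s) x y * path_prob p t y l' else 1.

(* Only the values of X at times t >= 0 are constrained.  The last condition is
   right-continuity of the paths for the discrete topology on T. *)
Record markov_chain (q : T -> T -> R) (d : measure_display)
    (Omega : measurableType d) (P : probability Omega R) (x0 : T)
    (X : R -> Omega -> T) : Prop := {
  mc_measurable : forall (t : R) y, 0 <= t -> measurable [set w | X t w = y];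
  mc_init : forall w, X 0 w = x0;
  mc_fdd : exists p, [/\ transition_function p, has_rates p q &
    forall l : seq (R * T), path <=%R 0 (map fst l) ->
      P [set w | forall ty : R * T, ty \in l -> X ty.1 w = ty.2] =
      (path_prob p 0 x0 l)%:E];
  mc_right_continuous : forall w (t : R), 0 <= t ->
    \forall s \near t^'+, X s w = X t w }.

End MarkovChain.

Section Elastic.
Context {R : realType} {n : nat}.
Variables (m a b : 'I_n.+1 -> R).
Context (d : measure_display) (Omega : measurableType d).
Variables (P : probability Omega R) (x0 : config n) (X : R -> Omega -> config n).

Definition elastic_system : Prop := markov_chain (Qmatrix m a b) P x0 X.

Definition limiting_speed (v : R) (i : 'I_n.+1) : Prop :=
  {ae P, forall w, (X t w i)%:~R / t @[t --> +oo] --> v}.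

Definition span_tail_bound (C delta : R) : Prop :=
  forall s : R, 0 <= s ->
    (ereal_sup [set P [set w | (s <= (config_span (X t w))%:~R)%R]
               | t in [set t : R | (0 <= t)%R]]
     <= (C * (1 + expR (C * (config_span x0)%:~R)) * expR (- (delta * s)))%:E)%E.

Definition span_log_growth : Prop :=
  {ae P, forall w,
    (limf_esup (fun t : R => ((config_span (X t w))%:~R / ln t)%:E) +oo%R < +oo)%E}.

Definition relative_stability (C delta : R) : Prop :=
  span_tail_bound C delta /\ span_log_growth.

End Elastic.

(* Main.v *)
(* The generator Q of the chain has bounded rates, so the superadditivity
   p_h(x, y) >= sum of p_s(x, z) p_(h-s)(z, y) over finitely many z turns the
   entrywise rates at time 0 into p_h >= 1 + h Q - O(h^2), uniformly in the
   starting point.  As rows sum to one, p_h is also bounded above by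
   1 + h Q + O(h^2) on bounded functions, and n steps of length t / n compare
   p_t f with any discrete supersolution: drift inequalities Q f <= c f or
   Q f <= - g f + K become bounds on E f(X_t).

   Within a cluster the pushes of all its particles are transferred to the
   extremal ones with momentum conserved, so that
   sum_i m_i (B_i - A_i) phi(x_i) = sum_i m_i (b_i - a_i) phi(x_i) for all phi.
   Hence the centre of mass has constant drift, and the centred second moment
   H(x) = sum_i m_i (x_i - xbar)^2 has the explicit drift
   2 sum_i m_i (b_i - a_i + U_N / M_N) x_i + O(1), which by Abel summation and
   the cloud condition is at most - 2 e (x_N - x_1) + O(1).  Therefore
   exp (delta sqrt (1 + H)) is a Lyapunov function, which controls the span;
   exponentials of the centre of mass control the speed, the passage from
   integer to all times being made by a maximal inequality.

   Conversely, let U_k / M_k >= U_N / M_N.  Then the centre of mass of all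
   particles minus that of the first k ones, D, lies between 0 and the span, and
   has nonnegative drift because collisions only push the first k particles to
   the left; since D moves at every jump, D^2 has drift bounded below, so E D^2
   is unbounded in time, contradicting the bound on the tail of the span. *)
Require Import Defs.
From mathcomp Require Import all_boot all_order all_algebra.
From mathcomp Require Import all_classical all_reals all_analysis.
From mathcomp Require Import ring lra zify.
Import Order.TTheory GRing.Theory Num.Theory.
Import numFieldNormedType.Exports.
Local Open Scope classical_set_scope.
Local Open Scope ring_scope.

(** * Bounds on transition functions with bounded rates *)

Section SumsOverAType.
Context {R : realType} {T : choiceType}.
Implicit Types (f g : T -> \bar R) (s : seq T).

Lemma sum_seq_le_esum f s : uniq s -> (forall y, 0 <= f y)%E ->
  (\sum_(y <- s) f y <= \esum_(y in setT) f y)%E.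
Proof.
move=> us f0; apply: esum_ge; exists [set` s]; first by split => //;
  exact: finite_seq.
by rewrite fsbig_seq.
Qed.

Lemma esum_le_of_seq f (M : \bar R) :
  (forall s, uniq s -> (\sum_(y <- s) f y <= M)%E) ->
  (\esum_(y in setT) f y <= M)%E.
Proof.
move=> H; apply: ge_ereal_sup => _ [A [finA _] <-].
by rewrite fsbig_finite//=; apply: H; exact: finmap.fset_uniq.
Qed.

(** Finite partial sums give one inequality; the other is the same inequality for the constant
    [c^-1] and the summands [c * f]. *)
Lemma esumZl f (c : R) : 0 <= c -> (forall y, 0 <= f y)%E ->
  (\esum_(y in setT) (c%:E * f y) = c%:E * \esum_(y in setT) f y)%E.
Proof.
move=> c0 f0.
have half g (e : R) : 0 <= e -> (forall y, 0 <= g y)%E ->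
    (\esum_(y in setT) (e%:E * g y) <= e%:E * \esum_(y in setT) g y)%E.
  move=> e0 g0; apply: esum_le_of_seq => s us.
  rewrite -ge0_sume_distrr//; apply: lee_wpmul2l; first by rewrite lee_fin.
  exact: sum_seq_le_esum.
apply/eqP; rewrite eq_le half//=.
have [->|cn0] := eqVneq c 0.
  by rewrite mul0e; apply: esum_ge0 => y _; rewrite mul0e.
have cp : 0 < c by rewrite lt_def cn0.
rewrite -[leRHS]mul1e.
have -> : (1%E = c%:E * (c^-1)%:E :> \bar R)%E by rewrite -EFinM divff.
rewrite -muleA; apply: lee_wpmul2l; first by rewrite lee_fin.
have := half (fun y => c%:E * f y)%E (c^-1).
rewrite (_ : \esum_(y in setT) ((c^-1)%:E * (c%:E * f y)) = \esum_(y in setT) f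
  y)%E.
  apply; first by rewrite invr_ge0.
  by move=> y; rewrite mule_ge0.
by apply: eq_esum => y _; rewrite muleA -EFinM mulVf// mul1e.
Qed.

Lemma esum_swap {T' : choiceType} (a : T -> T' -> \bar R) :
  (forall x y, 0 <= a x y)%E ->
  (\esum_(x in setT) \esum_(y in setT) a x y =
   \esum_(y in setT) \esum_(x in setT) a x y)%E.
Proof.
move=> a0; rewrite !esum_esum//.
rewrite (reindex_esum (setT `*`` (fun=> setT)) (setT `*`` (fun=> setT)) (fun z
  : T' * T => (z.2, z.1))) //.
split => //.
  by move=> [? ?] [? ?] _ _ /= [-> ->].
by move=> [u v] _; exists (v, u).
Qed.

End SumsOverAType.

Lemma sum_seq_pick {R : pzRingType} {T : eqType} (s : seq T) (z : T) (u : T ->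
  R) :
  uniq s -> z \in s -> \sum_(y <- s) (z == y)%:R * u y = u z.
Proof.
move=> us zs; rewrite (bigD1_seq z)//= eqxx mul1r big1 ?addr0// => y yz.
by rewrite eq_sym (negbTE yz) mul0r.
Qed.

Lemma bernoulli_le {R : realDomainType} (x : R) (n : nat) :
  0 <= x <= 1 -> 1 - n%:R * (1 - x) <= x ^+ n.
Proof.
move=> /andP[x0 x1]; elim: n => [|n IH]; first by rewrite expr0; lra.
rewrite exprS -natr1.
have h : x * (1 - n%:R * (1 - x)) <= x * x ^+ n by exact: ler_wpM2l.
have n0 : (0 : R) <= n%:R by [].
have : 0 <= n%:R * (1 - x) * (1 - x) by rewrite !mulr_ge0 ?subr_ge0.
by nra.
Qed.

(** * Short-time bounds for transition functions with bounded rates *)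

Section Generator.
Context {R : realType} {T : countType} {I : finType}.

(** The generator is presented by finitely many channels: from [x], channel [i] leads to [tau x i]
    at rate [r x i]. A channel with [tau x i = x] contributes nothing to [q], so dummy targets are
    harmless. *)
Record jump_generator (q : T -> T -> R) (r : T -> I -> R) (tau : T -> I -> T)
    (Lam : R) : Prop := JumpGenerator {
  jg_ge0 : forall x i, 0 <= r x i;
  jg_bound : forall x, \sum_i r x i <= Lam;
  jg_q : forall x y,
    q x y = \sum_i r x i * ((tau x i == y)%:R - (x == y)%:R) }.

Context {p : R -> T -> T -> R} {q : T -> T -> R} {r : T -> I -> R}
  {tau : T -> I -> T} {Lam : R}.
Hypotheses (tf : transition_function p) (pq : has_rates p q)
  (jg : jump_generator q r tau Lam).

Implicit Types (s t h e B : R) (x y z : T) (u v : T -> R).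

Let p0 t x y : 0 <= t -> 0 <= p t x y. Proof. exact: tf_ge0. Qed.
Let r0 x i : 0 <= r x i. Proof. exact: jg_ge0 jg x i. Qed.

Let Lam0 (x : T) : 0 <= Lam.
Proof. by apply: le_trans (jg_bound _ _ _ _ jg x); exact: sumr_ge0. Qed.

Lemma transition_le1 t x y : 0 <= t -> p t x y <= 1.
Proof.
move=> t0; rewrite -lee_fin -(tf_sum1 tf x t0).
have /= := @sum_seq_le_esum R T (fun y => (p t x y)%:E) [:: y] isT.
by rewrite big_seq1; apply=> z; rewrite lee_fin p0.
Qed.

Lemma chapman_kolmogorov_le (S : seq T) s t x z : uniq S -> 0 <= s -> 0 <= t ->
  \sum_(y <- S) p s x y * p t y z <= p (s + t) x z.
Proof.
move=> uS s0 t0; rewrite -lee_fin -(tf_semigroup tf x z s0 t0) -sumEFin.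
by apply: sum_seq_le_esum => // y; rewrite lee_fin mulr_ge0 ?p0.
Qed.

Lemma transition_rate_lower x y e : 0 < e -> exists2 h0, 0 < h0 &
  forall h, 0 < h < h0 -> h * (q x y - e) <= p h x y - (x == y)%:R.
Proof.
move=> e0; have /cvgrPdist_lt/(_ e e0) := pq x y.
rewrite near_withinE => -[h0 /= h00 H]; exists h0 => // h /andP[hp hh].
have /= := H h; rewrite sub0r normrN gtr0_norm// => /(_ hh hp).
rewrite ltr_distlC => /andP[+ _] => /ltW; rewrite ler_pdivlMr//.
by rewrite mulrC.
Qed.

Lemma exists_small_step (t h0 : R) : 0 < t -> 0 < h0 ->
  exists n : nat, 0 < t / n.+1%:R < h0.
Proof.
move=> t0 h00; exists (Num.truncn (t / h0)).
rewrite divr_gt0//= ltr_pdivrMr// -ltr_pdivrMl// mulrC.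
by exact: truncnS_gt.
Qed.

(** Being at [x] after each of the [n] steps is one way to be there at the end, so the [n]-th power
    of [p h x x] is a lower bound, which Bernoulli's inequality linearises. *)
Lemma transition_diag_pow h x n : 0 <= h ->
  1 - n%:R * (1 - p h x x) <= p (n%:R * h) x x.
Proof.
move=> h0; apply: (le_trans (bernoulli_le _ n _)).
  by rewrite p0//= transition_le1.
elim: n => [|n IH]; first by rewrite expr0 mul0r (tf_id tf) eqxx.
rewrite -natr1 mulrDl mul1r exprSr.
have := @chapman_kolmogorov_le [:: x] (n%:R * h) h x x isT.
rewrite big_seq1 => /(_ (mulr_ge0 (ler0n _ _) h0) h0); apply: le_trans.
by apply: ler_wpM2r => //; exact: p0.
Qed.

(** The derivative at 0 controls one step of length [t / n.+1] up to an error [e / t] per unit time;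
    over all steps the errors add up to the arbitrary [e]. *)
Lemma transition_diag_lower t x : 0 <= t -> 1 + t * q x x <= p t x x.
Proof.
rewrite le_eqVlt => /predU1P[<-|t0].
  by rewrite (tf_id tf) eqxx mul0r addr0.
apply/ler_addgt0Pl => e e0; have te : 0 < e / t by rewrite divr_gt0.
have [h0 h00 H] := transition_rate_lower x x _ te.
have [n /andP[n1 n2]] := exists_small_step t h0 t0 h00.
have := H _ (introT andP (conj n1 n2)); rewrite eqxx => {}H.
have nz : n.+1%:R != 0 :> R by rewrite pnatr_eq0.
have := transition_diag_pow _ x n.+1 (ltW n1).
rewrite [n.+1%:R * (_ / _)]mulrC divfK// => H2; rewrite -lerBlDl;
  apply: le_trans H2.
have /(ler_wpM2l (ler0n R n.+1)) := H.
rewrite (_ : n.+1%:R * (t / n.+1%:R * (q x x - e / t)) = t * q x x - e);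
  last first.
  by field; do ?[apply/andP; split]; rewrite ?gt_eqF ?ltr0n.
by rewrite /=; lra.
Qed.

Lemma rate_diag_ge x : - Lam <= q x x.
Proof.
rewrite (jg_q _ _ _ _ jg) lerNl -sumrN.
apply: le_trans (jg_bound _ _ _ _ jg x); apply: ler_sum => i _.
by rewrite eqxx; case: eqVneq => _ /=;
  rewrite ?subrr ?mulr0 ?oppr0 ?sub0r ?mulrN1 ?opprK.
Qed.

Lemma transition_diag_ge t x : 0 <= t -> 1 - t * Lam <= p t x x.
Proof.
move=> t0; apply: le_trans (transition_diag_lower t x t0).
by rewrite lerD2l -mulrN ler_wpM2l// rate_diag_ge.
Qed.

(* At most one jump from x to y takes place in the k steps: summing over the
   step at which it occurs gives the factor k. *)
Lemma transition_offdiag_iter h x y k : x != y -> 0 <= h -> h * Lam <= 1 ->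
  k%:R * p h x y * (1 - k%:R * h * Lam) <= p (k%:R * h) x y.
Proof.
move=> xy h0 hL; elim: k => [|k IH]; first by rewrite !mul0r p0.
have k0 : 0 <= k%:R * h by rewrite mulr_ge0.
have := @chapman_kolmogorov_le [:: x; y] (k%:R * h) h x y.
rewrite /= inE xy /= -natr1.
rewrite big_cons big_seq1 => /(_ isT k0 h0).
have -> : k%:R * h + h = (k%:R + 1) * h by ring.
apply: le_trans.
have D1 := transition_diag_ge _ x k0; have D2 := transition_diag_ge _ y h0.
have P0 := p0 h x y h0; have A0 := p0 _ x y k0.
have E1 := ler_wpM2r P0 D1; have E2 := ler_wpM2l A0 D2.
have hL1 : 0 <= 1 - h * Lam by rewrite subr_ge0.
have E3 := ler_wpM2r hL1 IH.
have L0 := Lam0 x.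
have F : 0 <= p h x y * (h * Lam) * (k%:R * (k%:R * (h * Lam)) + 1).
  by rewrite !mulr_ge0// ?addr_ge0 ?mulr_ge0.
by nra.
Qed.

Lemma transition_offdiag_lower t x y : x != y -> 0 <= t -> t * Lam <= 1 ->
  t * (1 - t * Lam) * q x y <= p t x y.
Proof.
move=> xy; rewrite le_eqVlt => /predU1P[<- _|t0 tL].
  by rewrite !mul0r p0.
have c0 : 0 <= 1 - t * Lam by rewrite subr_ge0.
have c1 : 1 - t * Lam <= 1 by rewrite gerBl mulr_ge0 ?(ltW t0) ?(Lam0 x).
apply/ler_addgt0Pl => e e0; have te : 0 < e / t by rewrite divr_gt0.
have [h0 h00 H] := transition_rate_lower x y _ te.
have [n /andP[n1 n2]] := exists_small_step t h0 t0 h00.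
have := H _ (introT andP (conj n1 n2)); rewrite (negbTE xy) subr0 => {}H.
have nz : n.+1%:R != 0 :> R by rewrite pnatr_eq0.
have hL : t / n.+1%:R * Lam <= 1.
  apply: le_trans tL; apply: ler_wpM2r; first exact: Lam0 x.
  by rewrite ler_pdivrMr ?ltr0n// ler_peMr ?ler1n// ltW.
have := transition_offdiag_iter _ x y n.+1 xy (ltW n1) hL.
rewrite [n.+1%:R * (_ / _)]mulrC divfK// => H2; rewrite -lerBlDl;
  apply: le_trans H2.
have /(ler_wpM2l (ler0n R n.+1)) /(ler_wpM2r c0) := H.
rewrite (_ : n.+1%:R * (t / n.+1%:R * (q x y - e / t)) = t * q x y - e);
  last first.
  by field; do ?[apply/andP; split]; rewrite ?gt_eqF ?ltr0n.
apply: le_trans.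
by nra.
Qed.

Lemma transition_lower h x y : 0 <= h -> h * Lam <= 1 ->
  (x == y)%:R * (1 - h * \sum_i r x i)
  + h * (1 - h * Lam) * \sum_i r x i * (tau x i == y)%:R <= p h x y.
Proof.
move=> h0 hL; have [<-|xy] := eqVneq x y; last first.
  rewrite mul0r add0r; apply: le_trans (transition_offdiag_lower h x y xy h0
    hL).
  rewrite (jg_q _ _ _ _ jg) (negbTE xy) /=.
  by under [in leRHS]eq_bigr do rewrite subr0.
rewrite mul1r; apply: le_trans (transition_diag_lower h x h0).
rewrite (jg_q _ _ _ _ jg) eqxx.
under [in leRHS]eq_bigr do rewrite mulrBr mulr1.
rewrite sumrB.
have : 0 <= \sum_i r x i * (tau x i == x)%:R by rewrite sumr_ge0// => i _;
  rewrite mulr_ge0.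
set S := \sum_i _ => S0.
have : 0 <= h * (h * Lam) * S by rewrite !mulr_ge0 ?(Lam0 x).
by lra.
Qed.

(** For nonnegative [u], the expectation of [u] at time [t] for the chain started at [x], possibly
    infinite. *)
Definition mean (p : R -> T -> T -> R) (t : R) (x : T) (u : T -> R) : \bar R :=
  \esum_(y in setT) (p t x y * u y)%:E.

Lemma le_mean t x u v : 0 <= t -> (forall y, u y <= v y) ->
  (mean p t x u <= mean p t x v)%E.
Proof.
by move=> t0 uv; apply: le_esum => y _; rewrite lee_fin ler_wpM2l ?p0.
Qed.

(** Only the starting point and the targets of a single jump are kept in the sum, with the bounds of
    [transition_lower]. *)
Lemma mean_lower h x u : 0 <= h -> h * Lam <= 1 -> (forall y, 0 <= u y) ->
  ((u x + h * (\sum_i r x i * (u (tau x i) - u x))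
    - h ^+ 2 * Lam * \sum_i r x i * u (tau x i))%:E <= mean p h x u)%E.
Proof.
move=> h0 hL u0.
pose S := undup (x :: [seq tau x i | i : I]).
have uS : uniq S by exact: undup_uniq.
have xS : x \in S by rewrite mem_undup inE eqxx.
have tS i : tau x i \in S.
  by rewrite mem_undup inE map_f ?orbT// mem_enum.
apply: le_trans (@sum_seq_le_esum _ _ _ S uS _); last first.
  by move=> y; rewrite lee_fin mulr_ge0 ?p0.
rewrite sumEFin lee_fin.
apply: (@le_trans _ _ (\sum_(y <- S) ((x == y)%:R * (1 - h * \sum_i r x i)
  + h * (1 - h * Lam) * \sum_i r x i * (tau x i == y)%:R) * u y)); last first.
  by apply: ler_sum => y _; rewrite ler_wpM2r// transition_lower.
under [leRHS]eq_bigr => y _.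
  rewrite (_ : (_ + _) * u y = (1 - h * \sum_i r x i) * ((x == y)%:R * u y)
    + h * (1 - h * Lam) * \sum_i r x i * ((tau x i == y)%:R * u y)); last first.
    rewrite -[X in _ = _ + _ * X](_ : (\sum_i r x i * (tau x i == y)%:R) * u y
      = _).
      by ring.
    by rewrite mulr_suml; apply: eq_bigr => i _; rewrite mulrA.
  over.
rewrite big_split/= -!mulr_sumr sum_seq_pick// exchange_big/=.
under [X in _ <= _ + _ * X]eq_bigr do rewrite -mulr_sumr sum_seq_pick//.
under [X in h * X]eq_bigr do rewrite mulrBr.
rewrite sumrB -mulr_suml.
set a := \sum_i _ * _; set b := \sum_i _.
rewrite le_eqVlt; apply/orP; left; apply/eqP; ring.
Qed.

(** The rows of [p h] sum to one, so an upper bound for [u] is a lower bound for [B - u]; this is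
    where boundedness of [u] enters. *)
Lemma mean_upper B h x u : 0 <= h -> h * Lam <= 1 ->
  (forall y, 0 <= u y <= B) ->
  (mean p h x u <=
    (u x + h * (\sum_i r x i * (u (tau x i) - u x)) + B * (h * Lam) ^+ 2)%:E)%E.
Proof.
move=> h0 hL u0.
have u1 y : 0 <= B - u y by rewrite subr_ge0; case/andP: (u0 y).
have := mean_lower h x _ h0 hL u1.
have : (mean p h x u + mean p h x (fun y => B - u y)%R = B%:E)%E.
  rewrite -esumD; [|by move=> y _; rewrite lee_fin mulr_ge0 ?p0//;
    case/andP: (u0 y)
    |by move=> y _; rewrite lee_fin mulr_ge0 ?p0].
  rewrite -[RHS]mule1 -(tf_sum1 tf x h0) -esumZl//.
  - by apply: eq_esum => y _; rewrite -EFinD -EFinM; congr EFin; ring.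
  - by case/andP: (u0 x) => a b; exact: le_trans b.
  - by move=> y; rewrite lee_fin p0.
have M0 : (0 <= mean p h x u)%E.
  by apply: esum_ge0 => y _; rewrite lee_fin mulr_ge0 ?p0//; case/andP: (u0 y).
have M1 : (0 <= mean p h x (fun y => B - u y)%R)%E.
  by apply: esum_ge0 => y _; rewrite lee_fin mulr_ge0 ?p0.
move: M0 M1; case: mean => [m1| |]//; case: mean => [m2| |]// _ _.
rewrite -EFinD => -[E]; rewrite !lee_fin => H.
have -> : m1 = B - m2 by rewrite -E addrK.
have {}H : B - m2 <= B - (B - u x + h * \sum_i r x i * (B - u (tau x i) - (B -
  u x)) -
    h ^+ 2 * Lam * \sum_i r x i * (B - u (tau x i))) by rewrite lerD2l lerN2.
apply: (le_trans H).
have -> : \sum_i r x i * (B - u (tau x i) - (B - u x)) = - \sum_i r x i * (u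
  (tau x i) - u x).
  by rewrite -sumrN; apply: eq_bigr => i _; ring.
have K : \sum_i r x i * (B - u (tau x i)) <= Lam * B.
  apply: (@le_trans _ _ (\sum_i r x i * B)).
    by apply: ler_sum => i _; rewrite ler_wpM2l// gerBl;
      case/andP: (u0 (tau x i)).
  rewrite -mulr_suml ler_wpM2r//; last exact: jg_bound jg x.
  by case/andP: (u0 x) => a b; exact: le_trans b.
have hh : 0 <= h ^+ 2 * Lam by rewrite mulr_ge0 ?sqr_ge0 ?(Lam0 x).
have := ler_wpM2l hh K.
rewrite !expr2; set s1 := \sum_i _; set s2 := \sum_i _ => K'.
by lra.
Qed.
End Generator.

(** * From drift inequalities to bounds on expectations *)

Section Comparison.
Context {R : realType} {T : countType} {I : finType}.
Context {p : R -> T -> T -> R} {q : T -> T -> R} {r : T -> I -> R}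
  {tau : T -> I -> T} {Lam : R}.
Hypotheses (tf : transition_function p) (pq : has_rates p q)
  (jg : jump_generator q r tau Lam).
Implicit Types (s t h e B c K : R) (x y z : T) (u v f : T -> R).

Let p0 t x y : 0 <= t -> 0 <= p t x y. Proof. exact: tf_ge0. Qed.
Let r0 x i : 0 <= r x i. Proof. exact: jg_ge0 jg x i. Qed.
Let Lam0 (x : T) : 0 <= Lam.
Proof. by apply: le_trans (jg_bound _ _ _ _ jg x); exact: sumr_ge0. Qed.

Lemma mean_ge0 t x u : 0 <= t -> (forall y, 0 <= u y) -> (0 <= mean p t x u)%E.
Proof. by move=> t0 u0; apply: esum_ge0 => y _;
  rewrite lee_fin mulr_ge0 ?p0. Qed.

Lemma mean_add s t x u : 0 <= s -> 0 <= t -> (forall y, 0 <= u y) ->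
  (mean p (s + t) x u = \esum_(y in setT) ((p s x y)%:E * mean p t y u))%E.
Proof.
move=> s0 t0 u0; rewrite /mean.
under eq_esum => z _.
  rewrite EFinM -(tf_semigroup tf x z s0 t0) muleC -esumZl//; last first.
    by move=> y; rewrite lee_fin mulr_ge0 ?p0.
  over.
rewrite esum_swap; last first.
  by move=> z y; rewrite -EFinM lee_fin !mulr_ge0 ?p0.
apply: eq_esum => y _; rewrite -esumZl ?p0//; last first.
  by move=> z; rewrite lee_fin mulr_ge0 ?p0.
by apply: eq_esum => z _; rewrite -!EFinM; congr EFin; ring.
Qed.

Section FinitelySupported.
Context (S : seq T) (uS : uniq S) (f : T -> R).
Hypothesis f0 : forall x, 0 <= f x.

(** Truncation to the finite set [S] makes the expectation bounded in [x], as [mean_upper] requires;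
    bounds uniform in [S] pass to the full sum. *)
Let u t x := \sum_(z <- S) p t x z * f z.

Let u0 t x : 0 <= t -> 0 <= u t x.
Proof. by move=> t0; apply: sumr_ge0 => z _; rewrite mulr_ge0 ?p0. Qed.

Let uB t x B : 0 <= B -> 0 <= t -> (forall z,
  z \in S -> f z <= B) -> u t x <= B.
Proof.
move=> B0 t0 fB; apply: (@le_trans _ _ (\sum_(z <- S) p t x z * B)).
  by rewrite /u !big_seq; apply: ler_sum => z zS; rewrite ler_wpM2l ?p0// fB.
rewrite -mulr_suml ler_piMl//.
rewrite -lee_fin -sumEFin -(tf_sum1 tf x t0).
by apply: sum_seq_le_esum => // y; rewrite lee_fin p0.
Qed.

Let u_step h t x : 0 <= h -> 0 <= t -> ((u (h + t) x)%:E <= mean p h x (u t))%E.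
Proof.
move=> h0 t0; rewrite /u -sumEFin.
under eq_bigr => z _.
  rewrite EFinM -(tf_semigroup tf x z h0 t0) muleC -esumZl//; last first.
    by move=> y; rewrite lee_fin mulr_ge0 ?p0.
  over.
rewrite -esum_sum; last by move=> y z _ _; rewrite -EFinM lee_fin !mulr_ge0 ?p0.
apply: le_esum => y _; under eq_bigr do rewrite -EFinM.
rewrite sumEFin lee_fin mulr_sumr; apply: ler_sum => z _.
by rewrite le_eqVlt; apply/orP; left; apply/eqP; ring.
Qed.

(** Induction on [k], conditioning on the first step: each step multiplies by [lam], adds [kap] and
    costs the second-order error of [mean_upper]. *)
Lemma discrete_comparison B h lam kap k x :
  0 <= h -> h * Lam <= 1 -> 0 <= lam -> 0 <= B ->
  (forall z, z \in S -> f z <= B) ->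
  (forall y, f y + h * (\sum_i r y i * (f (tau y i) - f y)) <= lam * f y + kap)
    ->
  \sum_(z <- S) p (k%:R * h) x z * f z <=
    lam ^+ k * f x + kap * (\sum_(j < k) lam ^+ j) + k%:R * (B * (h * Lam) ^+
      2).
Proof.
move=> h0 hL l0 B0 fB H; rewrite -/(u _ _); elim: k x => [|k IH] x.
  rewrite !mul0r expr0 mul1r big_ord0 mulr0 !addr0 /u.
  under eq_bigr do rewrite (tf_id tf).
  have [xS|xS] := boolP (x \in S); first by rewrite sum_seq_pick.
  rewrite big_seq big1// => z zS; case: eqVneq => [E|_]; last by rewrite mul0r.
  by rewrite E zS in xS.
have k0 : 0 <= k%:R * h by rewrite mulr_ge0.
rewrite -natr1 mulrDl mul1r addrC.
rewrite -lee_fin; apply: (le_trans (u_step _ _ x h0 k0)).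
have ub y : 0 <= u (k%:R * h) y <= B by rewrite u0//= uB.
apply: (le_trans (mean_upper tf pq jg B h x _ h0 hL ub)); rewrite lee_fin.
set C := kap * (\sum_(j < k) lam ^+ j) + k%:R * (B * (h * Lam) ^+ 2).
have {}IH y : u (k%:R * h) y <= lam ^+ k * f y + C by rewrite /C addrA IH.
(* As [h * Lam <= 1], the operator [1 + h Q] is an average with nonnegative weights; hence it is
   monotone and fixes constants, and the induction hypothesis may be inserted under it. *)
have stoch v : v x + h * (\sum_i r x i * (v (tau x i) - v x)) =
    (1 - h * \sum_i r x i) * v x + h * \sum_i r x i * v (tau x i).
  under eq_bigr do rewrite mulrBr.
  by rewrite sumrB -mulr_suml; ring.
have w0 : 0 <= 1 - h * \sum_i r x i.
  by rewrite subr_ge0; apply: le_trans hL;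
    rewrite ler_wpM2l// (jg_bound _ _ _ _ jg).
have G : u (k%:R * h) x + h * (\sum_i r x i * (u (k%:R * h) (tau x i) - u (k%:R
  * h) x))
   <= lam ^+ k * (f x + h * (\sum_i r x i * (f (tau x i) - f x))) + C.
  rewrite !stoch.
  apply: (@le_trans _ _ ((1 - h * \sum_i r x i) * (lam ^+ k * f x + C) +
      h * \sum_i r x i * (lam ^+ k * f (tau x i) + C))).
    apply: lerD; first exact: ler_wpM2l.
    by rewrite ler_wpM2l//; apply: ler_sum => i _; rewrite ler_wpM2l.
  under [X in _ + h * X]eq_bigr do rewrite mulrDr mulrCA.
  rewrite big_split/= -mulr_sumr -mulr_suml.
  by rewrite le_eqVlt; apply/orP; left; apply/eqP; ring.
have := ler_wpM2l (exprn_ge0 k l0) (H x).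
rewrite big_ord_recr/= [lam ^+ k.+1]exprSr; move: G; rewrite /C.
by lra.
Qed.

End FinitelySupported.

(** Reduces a drift inequality to a scalar estimate: [M] has to dominate the Euler scheme of the
    corresponding linear equation for every sufficiently fine mesh. *)
Lemma mean_comparison f c K t x (M : R) : (forall y, 0 <= f y) -> 0 <= t ->
  (forall y, \sum_i r y i * (f (tau y i) - f y) <= c * f y + K) ->
  (forall n h, t = n.+1%:R * h -> 0 <= h -> h * `|c| <= 1 ->
     (1 + h * c) ^+ n.+1 * f x + h * K * (\sum_(j < n.+1) (1 + h * c) ^+ j) <=
       M) ->
  (mean p t x f <= M%:E)%E.
Proof.
move=> f0 t0 Hf HM; apply: esum_le_of_seq => S uS.
rewrite sumEFin lee_fin; apply/ler_addgt0Pr => e e0.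
have [B [B0 fB]] : exists B, 0 <= B /\ forall z, z \in S -> f z <= B.
  exists (\sum_(z <- S) f z); split; first exact: sumr_ge0.
  by move=> z zS; rewrite (big_rem z)//= lerDl sumr_ge0.
(* Besides positivity, the terms of the denominator bound [h * Lam] and [h] times the absolute value
   of [c] by one, and the accumulated second-order error [h * t * B * Lam ^+ 2] by [e]. *)
pose h0 : R := (1 + Lam + `|c| + t * B * Lam ^+ 2 / e)^-1.
have d0 : 0 <= t * B * Lam ^+ 2 / e.
  by rewrite !mulr_ge0 ?sqr_ge0 ?invr_ge0 ?(Lam0 x) ?(ltW e0).
have L0 := Lam0 x; have c0 := normr_ge0 c.
have dp : 0 < 1 + Lam + `|c| + t * B * Lam ^+ 2 / e by lra.
have h00 : 0 < h0 by rewrite invr_gt0.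
have [n [h [hE hp hh]]] : exists n h, [/\ t = n.+1%:R * h, 0 <= h & h <= h0].
  have [->|tn0] := eqVneq t 0; first by exists 0, 0; rewrite mulr0 lexx ltW.
  have tp : 0 < t by rewrite lt_def tn0.
  have [n /andP[n1 n2]] := exists_small_step t h0 tp h00.
  exists n, (t / n.+1%:R); split; [|exact: ltW|exact: ltW].
  by rewrite mulrC divfK ?pnatr_eq0.
have hd : h * (1 + Lam + `|c| + t * B * Lam ^+ 2 / e) <= 1.
  by rewrite -ler_pdivlMr// mul1r.
have a1 : 0 <= h * Lam by rewrite mulr_ge0.
have a2 : 0 <= h * `|c| by rewrite mulr_ge0.
have a3 : 0 <= h * (t * B * Lam ^+ 2 / e) by rewrite mulr_ge0.
have hc : h * `|c| <= 1 by lra.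
have hL : h * Lam <= 1 by lra.
have he : h * (t * B * Lam ^+ 2) <= e.
  have : h * (t * B * Lam ^+ 2 / e) <= 1 by lra.
  by rewrite mulrA ler_pdivrMr// mul1r.
have l0 : 0 <= 1 + h * c.
  have : `|h * c| <= 1 by rewrite normrM (ger0_norm hp).
  by rewrite ler_norml => /andP[+ _]; lra.
have := @discrete_comparison S uS f f0 B h (1 + h * c) (h * K) n.+1 x hp hL l0
  B0 fB.
rewrite -hE => /(_ _)/le_trans; apply.
  move=> y; have := ler_wpM2l hp (Hf y); rewrite mulrDr mulrDl mul1r; lra.
apply: lerD; first exact: HM.
rewrite (_ : _ * (B * _) = h * (n.+1%:R * h * B * Lam ^+ 2)); last by ring.
by rewrite -hE.
Qed.

Lemma mean_le_expR f c t x : (forall y, 0 <= f y) -> 0 <= t ->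
  (forall y, \sum_i r y i * (f (tau y i) - f y) <= c * f y) ->
  (mean p t x f <= (expR (c * t) * f x)%:E)%E.
Proof.
move=> f0 t0 Hf; apply: (@mean_comparison f c 0) => //.
  by move=> y; rewrite addr0.
move=> n h tE h0 hc; rewrite mulr0 mul0r addr0 ler_wpM2r// tE.
have l0 : 0 <= 1 + h * c.
  have : `|h * c| <= 1 by rewrite normrM (ger0_norm h0).
  by rewrite ler_norml => /andP[+ _]; lra.
rewrite (_ : c * _ = h * c * n.+1%:R) ?expRM_natr; last by ring.
by apply: lerXn2r; rewrite ?nnegrE ?expR_ge0// expR_ge1Dx.
Qed.

(** The Euler factor [1 - h * g] lies between 0 and 1, so its geometric series is at most
    [1 / (h * g)], whatever the number of steps; hence the bound is uniform in time. *)
Lemma mean_le_lyapunov f g K t x : (forall y, 0 <= f y) -> 0 <= t -> 0 < g ->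
  0 <= K -> (forall y, \sum_i r y i * (f (tau y i) - f y) <= - g * f y + K) ->
  (mean p t x f <= (f x + K / g)%:E)%E.
Proof.
move=> f0 t0 g0 K0 Hf; apply: (@mean_comparison f (- g) K) => //.
move=> n h tE h0; rewrite normrN gtr0_norm// => hg.
have hg0 : 0 <= h * g by rewrite mulr_ge0 ?(ltW g0).
have l0 : 0 <= 1 + h * - g by lra.
have l1 : 1 + h * - g <= 1 by lra.
apply: lerD; first by rewrite ler_piMl// exprn_ile1.
rewrite ler_pdivlMr//.
have := subrX1 (1 + h * - g) n.+1; set S := \sum_(_ < _) _ => E.
have E' : h * g * S = 1 - (1 + h * - g) ^+ n.+1 by move: E; lra.
rewrite (_ : _ * g = K * (h * g * S)); last by ring.
by rewrite E' ler_piMr// gerBl exprn_ge0.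
Qed.

End Comparison.

(** * Events along paths *)

Section BorelCantelli.
Context {R : realType} {d : measure_display} {Omega : measurableType d}.
Variable P : probability Omega R.

Lemma borel_cantelli_eventually (E : (set Omega)^nat) (e : R^nat) (M : R) :
  (forall k, measurable (E k)) -> (forall k, (P (E k) <= (e k)%:E)%E) ->
  (forall n, \sum_(k < n) e k <= M) ->
  {ae P, forall w, exists K, forall k, (K <= k)%N -> ~ E k w}.
Proof.
move=> mE PE eM; exists (lim_sup_set E); split.
- apply: bigcap_measurable => // k _.
  by apply: bigcup_measurable => j _; exact: mE.
- apply: lim_sup_set_cvg0 => //; apply: (@le_lt_trans _ _ M%:E);
  last exact: ltry.
  apply: lime_le; first exact: is_cvg_nneseries.
  apply: nearW => n; rewrite big_mkord;
    apply: le_trans (_ : _ <= (\sum_(k < n) e k)%:E)%E _.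
    by rewrite -sumEFin; apply: lee_sum => k _; exact: PE.
  by rewrite lee_fin.
- move=> w /= nE K _; apply: contrapT => h; apply: nE; exists K => k Kk Ekw.
  by apply: h; exists k.
Qed.

End BorelCantelli.

(** * Maximal inequality and almost sure bounds along paths *)

Section Paths.
Context {R : realType} {T : countType} {d : measure_display}
  {Omega : measurableType d}.
Context {P : probability Omega R} {x0 : T} {X : R -> Omega -> T}
  {p : R -> T -> T -> R}.
Hypotheses (tf : transition_function p)
  (mX : forall (t : R) y, 0 <= t -> measurable [set w | X t w = y])
  (fdd : forall l : seq (R * T), path <=%R 0 (map fst l) ->
      P [set w | forall ty : R * T, ty \in l -> X ty.1 w = ty.2] =
      (path_prob p 0 x0 l)%:E)
  (rcX : forall w (t : R), 0 <= t -> \forall s \near t^'+, X s w = X t w).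
Implicit Types (s t c : R) (x y : T) (f : T -> R).

(** The states are coded in [nat] by [pickle], so that countable additivity applies; codes of no
    state give empty events. *)
Lemma total_probability (F : set Omega) t : measurable F -> 0 <= t ->
  (P F = \esum_(y in setT) P (F `&` [set w | X t w = y]))%E.
Proof.
move=> mF t0; pose G (n : nat) := F `&` [set w | pickle (X t w) = n].
have GE y : F `&` [set w | X t w = y] = G (pickle y).
  rewrite /G; congr (_ `&` _); apply/seteqP; split => w /=; first by move=> ->.
  exact: (pcan_inj pickleK).
have G0 n : (forall y, pickle y <> n) -> G n = set0.
  by move=> h; rewrite -subset0 => w [_ /= E]; exact: (h _ E).
have mG n : measurable (G n).
  have [[y <-]|h] := pselect (exists y : T, pickle y = n).
    by rewrite -GE; apply: measurableI => //; exact: mX.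
  by rewrite G0// => y yn; apply: h; exists y.
rewrite (_ : F = \bigcup_n G n); last first.
  apply/seteqP; split => [w Fw|w [n _ []]//].
  by exists (pickle (X t w)).
rewrite measure_bigcup//; last first.
  by move=> i j _ _ [w [[_ /= <-] [_ /= <-]]].
rewrite nneseries_esum// set_mem_set.
under [RHS]eq_esum => y _.
  rewrite (_ : _ `&` _ = G (pickle y)); last first.
    rewrite -GE; apply/seteqP; split => w [].
      by move=> [n _ [Fw _]] Xy; split.
    by move=> Fw Xy; split => //; exists (pickle (X t w)).
  over.
rewrite -(esum_image setT pickle (fun n => P (G n))); last first.
  by apply: in2W; exact: pcan_inj pickleK.
rewrite [RHS]esum_mkcond; apply: eq_esum => n _.
case: ifPn => //; rewrite notin_setE => h.
by rewrite G0 ?measure0// => y yn; apply: h; exists y.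
Qed.


Lemma measurable_state (A : set T) t : 0 <= t -> measurable [set w | A (X t w)].
Proof.
move=> t0; rewrite (_ : mkset _ = \bigcup_y (if y \in A then [set w | X t w =
  y] else set0)).
  apply: countable_bigcupT_measurable; first exact: countableP.
  by move=> y; case: ifP => _ //; exact: mX.
apply/seteqP; split => w /=; first by move=> Aw; exists (X t w) => //;
  rewrite mem_set.
by move=> [y _]; case: ifPn => // /set_mem Ay /= ->.
Qed.

Let follows (l : seq (R * T)) : set Omega :=
  [set w | forall ty : R * T, ty \in l -> X ty.1 w = ty.2].

Let follows_rcons l t y :
  follows (rcons l (t, y)) = follows l `&` [set w | X t w = y].
Proof.
apply/seteqP; split => w /=.
  move=> H; split; last by apply: (H (t, y)); rewrite mem_rcons mem_head.
  by move=> ty tyl; apply: H; rewrite mem_rcons inE tyl orbT.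
by move=> [H Xy] ty; rewrite mem_rcons inE => /predU1P[->//|]; exact: H.
Qed.

Let measurable_follows l : path <=%R 0 (map fst l) -> measurable (follows l).
Proof.
elim/last_ind: l => [_|l [t y] IH].
  by rewrite (_ : follows _ = setT)// -subTset => w _ ?.
rewrite map_rcons rcons_path /= => /andP[pl lt]; rewrite follows_rcons.
apply: measurableI; first exact: IH.
apply: mX; apply: le_trans lt.
elim/last_ind: {IH} l pl => [//|l u _]; rewrite map_rcons last_rcons.
move=> /(order_path_min le_trans) /allP; apply.
by rewrite mem_rcons mem_head.
Qed.

Lemma path_prob_rcons s x l t y :
  path_prob p s x (rcons l (t, y)) =
  path_prob p s x l * p (t - (last (s, x) l).1) (last (s, x) l).2 y.
Proof.
elim: l s x => [|[u z] l IH] s x /=; first by rewrite mul1r mulr1.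
by rewrite IH mulrA.
Qed.

Lemma path_prob_ge0 s x l : path <=%R s (map fst l) -> 0 <= path_prob p s x l.
Proof.
elim: l s x => [|[u z] l IH] s x //= /andP[su ul].
by rewrite mulr_ge0 ?IH// (tf_ge0 tf) ?subr_ge0.
Qed.

Let hits (f : T -> R) (a : R) (ts : seq R) : set Omega :=
  [set w | exists2 t, t \in ts & a <= f (X t w)].

Let hits_cons f a t ts :
  hits f a (t :: ts) = [set w | a <= f (X t w)] `|` hits f a ts.
Proof.
apply/seteqP; split => w /=.
  move=> [u]; rewrite inE => /predU1P[-> h|uts h]; first by left.
  by right; exists u.
move=> [h|[u uts h]]; first by exists t; rewrite ?mem_head.
by exists u; rewrite // inE uts orbT.
Qed.

Let measurable_hits f a ts : (forall t, t \in ts -> 0 <= t) ->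
  measurable (hits f a ts).
Proof.
elim: ts => [_|t ts IH H].
  by rewrite (_ : hits _ _ _ = set0)// -subset0 => w [].
rewrite hits_cons; apply: measurableU.
  by apply: (measurable_state [set y | a <= f y]); apply: H; rewrite mem_head.
by apply: IH => u uts; apply: H; rewrite inE uts orbT.
Qed.

Section Maximal.
Context (f : T -> R) (c a : R).
Hypotheses (f0 : forall x, 0 <= f x) (c0 : 0 <= c) (a0 : 0 < a).
Hypothesis fc : forall t x, 0 <= t -> (mean p t x f <= (expR (c * t) * f
  x)%:E)%E.

Lemma path_last_ge (s : R) (l : seq (R * T)) x : path <=%R s (map fst l) ->
  s <= (last (s, x) l).1.
Proof.
elim: l s x => [|[u z] l IH] s x //= /andP[su /(IH u z)]; exact: le_trans.
Qed.

(* Optional stopping for the supermartingale expR (- c * t) * f (X t): the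
   induction conditions on the state at the first time of the list. *)
Lemma maximal_inequality_from (l : seq (R * T)) (ts : seq R) (te : R) :
  path <=%R 0 (map fst l) -> path <=%R (last (0, x0) l).1 ts ->
  last (last (0, x0) l).1 ts <= te ->
  (P (follows l `&` hits f a ts) <= (path_prob p 0 x0 l *
    (expR (c * (te - (last (0, x0) l).1)) * f (last (0, x0) l).2 / a))%:E)%E.
Proof.
elim: ts l => [|t ts IH] l pl /=.
  move=> _ _; rewrite (_ : _ `&` _ = set0); last first.
    by rewrite -subset0 => w [_ []].
  by rewrite measure0 lee_fin !mulr_ge0 ?path_prob_ge0 ?expR_ge0 ?invr_ge0//
    ltW.
set s := (last _ _).1; set x := (last _ _).2 => /andP[st tts] te1.
have s0 : 0 <= s by exact: path_last_ge.
have t0 : 0 <= t by exact: le_trans st.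
have tte : t <= te.
  apply: le_trans te1; elim: (ts) (t) tts => [//|v vs IHv] u /= /andP[uv /IHv].
  exact: le_trans.
have ts0 u : u \in t :: ts -> 0 <= u.
  rewrite inE => /predU1P[->//|uts]; apply: (le_trans t0).
  by move: (order_path_min le_trans tts) => /allP; apply.
have mF : measurable (follows l `&` hits f a (t :: ts)).
  by apply: measurableI; [exact: measurable_follows|exact: measurable_hits].
rewrite (total_probability _ t mF t0).
have pp0 := path_prob_ge0 0 x0 l pl.
apply: (@le_trans _ _ (\esum_(y in setT) ((path_prob p 0 x0 l * expR (c * (te -
  t)) / a)%:E *
    (p (t - s) x y * f y)%:E))%E); last first.
  have ts00 : 0 <= t - s by rewrite subr_ge0.
  rewrite esumZl; [|by rewrite !mulr_ge0 ?expR_ge0 ?invr_ge0// ltW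
    |by move=> y; rewrite lee_fin mulr_ge0 ?(tf_ge0 tf)].
  apply: le_trans (lee_wpmul2l _ (fc _ x ts00)) _.
    by rewrite lee_fin !mulr_ge0 ?expR_ge0 ?invr_ge0// ltW.
  rewrite -EFinM lee_fin.
  have -> : expR (c * (te - s)) = expR (c * (te - t)) * expR (c * (t - s)).
    by rewrite -expRD; congr expR; ring.
  by rewrite le_eqVlt; apply/orP; left; apply/eqP; ring.
apply: le_esum => y _; rewrite -EFinM.
pose l' := rcons l (t, y).
have pl' : path <=%R 0 (map fst l').
  rewrite map_rcons rcons_path pl /=.
  by rewrite (_ : last 0 _ = s)// /s (last_map fst l (0, x0)).
have ll' : last (0, x0) l' = (t, y) by rewrite last_rcons.
have ppl' : path_prob p 0 x0 l' = path_prob p 0 x0 l * p (t - s) x y.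
  by rewrite path_prob_rcons.
have pp'0 := path_prob_ge0 0 x0 l' pl'.
(* If [f y] reaches [a], the claimed bound already exceeds the probability of the extended path;
   otherwise the level is reached at a later time and the induction hypothesis applies to that
   path. *)
have [afy|fya] := leP a (f y).
  apply: (@le_trans _ _ (P (follows l'))).
    rewrite le_measure ?inE//; [|exact: measurable_follows|].
      by apply: measurableI => //; exact: mX.
    by rewrite /l' follows_rcons => w [[Fw _] Xy]; split.
  rewrite fdd// lee_fin ppl'.
  rewrite (_ : _ * _ / a * _ = path_prob p 0 x0 l * p (t - s) x y * (expR (c *
    (te - t)) * (f y / a))); last by ring.
  rewrite -ppl' ler_peMr// -[1]mul1r; apply: ler_pM => //.
    by rewrite -expR0 ler_expR mulr_ge0// subr_ge0.
  by rewrite ler_pdivlMr// mul1r.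
have := IH l' pl'; rewrite ll' /= => /(_ tts te1).
rewrite ppl' (_ : _ * _ * (_ * f y / a) = path_prob p 0 x0 l * expR (c * (te -
  t)) / a *
  (p (t - s) x y * f y)); last by ring.
apply: le_trans; rewrite le_measure ?inE//.
- by apply: measurableI => //; exact: mX.
- apply: measurableI; first exact: measurable_follows.
  by apply: measurable_hits => u uts; apply: ts0; rewrite inE uts orbT.
rewrite /l' follows_rcons hits_cons => w [[Fw [/= afX|H]] Xy]; last by split.
by move: afX; rewrite Xy leNgt fya.
Qed.

Lemma maximal_inequality_seq (s te : R) (ts : seq R) : 0 <= s ->
  path <=%R s ts -> last s ts <= te ->
  (P (hits f a ts) <= (expR (c * (te - s)) / a)%:E * mean p s x0 f)%E.
Proof.
move=> s0 sts tse.
have ts0 u : u \in ts -> 0 <= u.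
  move=> uts; apply: (le_trans s0).
  by move: (order_path_min le_trans sts) => /allP; apply.
have mH : measurable (hits f a ts) by exact: measurable_hits.
rewrite (total_probability _ s mH s0) -esumZl; last 2 first.
- by rewrite mulr_ge0 ?expR_ge0 ?invr_ge0// ltW.
- by move=> y; rewrite lee_fin mulr_ge0 ?(tf_ge0 tf).
apply: le_esum => y _.
have := maximal_inequality_from [:: (s, y)] ts te.
rewrite /= s0 subr0 mulr1 => /(_ isT sts tse).
rewrite (_ : follows _ = [set w | X s w = y]); last first.
  by rewrite -[_ :: _]/(rcons [::] (s, y)) follows_rcons; apply/seteqP;
    split => w // [].
rewrite setIC -EFinM => /le_trans; apply.
by rewrite lee_fin le_eqVlt; apply/orP; left; apply/eqP; ring.
Qed.

(** The rational times in the interval with code below [n] give increasing events, so the finite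
    bound passes to their union. By right-continuity any state is still held at some later rational
    time; [t < te] leaves room for it. *)
Lemma maximal_inequality (s te : R) : 0 <= s -> s <= te ->
  exists E : set Omega, [/\ measurable E,
    (P E <= (expR (c * (te - s)) / a)%:E * mean p s x0 f)%E &
    forall w t, s <= t < te -> a <= f (X t w) -> E w].
Proof.
move=> s0 ste.
pose ts (n : nat) : seq R := sort <=%R [seq u <- [seq ratr u | u <- pmap
  unpickle (iota 0 n)] | s <= u <= te].
have tsP n u : u \in ts n -> s <= u <= te.
  by rewrite mem_sort mem_filter => /andP[].
have tsS n k : (n <= k)%N -> {subset ts n <= ts k}.
  move=> nk u; rewrite !mem_sort !mem_filter => /andP[-> /=].
  move=> /mapP[v vn ->]; apply: map_f; move: vn; rewrite !mem_pmap.
  move=> /mapP[i iN ->]; apply: map_f; move: iN; rewrite !mem_iota !add0n /=.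
  by move=> /leq_trans; apply.
have tsp n : path <=%R s (ts n).
  rewrite path_sortedE; last exact: le_trans.
  rewrite sort_sorted ?andbT; last exact: le_total.
  by apply/allP => u /tsP /andP[].
have tsl n : last s (ts n) <= te.
  have : last s (ts n) \in s :: ts n by exact: mem_last.
  by rewrite inE => /predU1P[->//|/tsP /andP[]].
have mH n : measurable (hits f a (ts n)).
  by apply: measurable_hits => u /tsP /andP[su _]; exact: le_trans su.
exists (\bigcup_n hits f a (ts n)); split.
- exact: bigcup_measurable.
- have ndH : nondecreasing_seq (fun n => hits f a (ts n)).
    move=> n k nk; apply/subsetPset => w [u un h]; exists u => //;
      exact: tsS un.
  have mU := bigcup_measurable (fun n (_ : setT n) => mH n).
  apply: cvge_le (nondecreasing_cvg_mu mH mU ndH).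
  by apply: nearW => n; exact: maximal_inequality_seq.
- move=> w t /andP[st tte] afX.
  have t0 : 0 <= t by exact: le_trans st.
  have := rcX w t t0; rewrite near_withinE => -[e /= e0 H].
  have tm : t < Num.min te (t + e) by rewrite lt_min tte ltrDl.
  have [v] := rat_in_itvoo tm; rewrite in_itv /= lt_min =>
    /andP[tv /andP[vte vte']].
  exists (pickle v).+1 => //; exists (ratr v).
    rewrite mem_sort mem_filter; apply/andP; split.
      by rewrite (le_trans st (ltW tv)) (ltW vte).
    apply: map_f; rewrite mem_pmap; apply/mapP; exists (pickle v);
      last by rewrite pickleK.
    by rewrite mem_iota leq0n /= ltnSn.
  have -> // : X (ratr v) w = X t w.
  by apply: H => //=; rewrite distrC gtr0_norm ?subr_gt0// ltrBlDl.
Qed.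

End Maximal.

(** On the unit interval from [k] to [k + 1] the maximal inequality bounds the probability of
    reaching [lvl k] by [expR c * (mu k / lvl k)]; Borel-Cantelli then covers all large real times
    at once. *)
Lemma eventually_below f c (lvl mu : R^nat) (B : R) :
  (forall x, 0 <= f x) -> 0 <= c -> (forall k, 0 < lvl k) ->
  (forall t x, 0 <= t -> (mean p t x f <= (expR (c * t) * f x)%:E)%E) ->
  (forall k : nat, (mean p k%:R x0 f <= (mu k)%:E)%E) ->
  (forall k : nat, \sum_(i < k) mu i / lvl i <= B) ->
  {ae P, forall w, exists K : nat, forall t, K%:R <= t -> 0 <= t ->
     f (X t w) < lvl (Num.truncn t)}.
Proof.
move=> f0 c0 l0 fc fmu sB.
have step k : exists E : set Omega, [/\ measurable E,
    (P E <= (expR c * (mu k / lvl k))%:E)%E &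
    forall w t, k%:R <= t < k.+1%:R -> lvl k <= f (X t w) -> E w].
  have kk1 : k%:R <= k.+1%:R :> R by rewrite ler_nat.
  have [E [mE PE EP]] := maximal_inequality f c (lvl k) f0 c0 (l0 k) fc k%:R
    k.+1%:R (ler0n _ _) kk1.
  exists E; split => //; apply: (le_trans PE).
  rewrite (_ : k.+1%:R - k%:R = 1 :> R) ?mulr1; last by rewrite -natr1; ring.
  rewrite (_ : expR c * (mu k / lvl k) = expR c / lvl k * mu k); last by ring.
  rewrite [leRHS]EFinM; apply: lee_wpmul2l => //.
  by rewrite lee_fin divr_ge0 ?expR_ge0// ltW.
have [E EP] := choice step.
have := @borel_cantelli_eventually R d Omega P E (fun k =>
  expR c * (mu k / lvl k)) (expR c * B).
move=> /(_ _ _ _) H; apply: filterS (H _ _ _).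
- move=> w [K KP]; exists K => t Kt t0; rewrite ltNge; apply/negP => h.
  have Ktr : (K <= Num.truncn t)%N by rewrite truncn_ge_nat.
  have [_ _ E3] := EP (Num.truncn t).
  by apply: (KP _ Ktr); apply: E3 h; rewrite truncn_le t0 truncnS_gt.
- by move=> k; have [] := EP k.
- by move=> k; have [] := EP k.
- by move=> k; rewrite -mulr_sumr ler_wpM2l ?expR_ge0.
Qed.

End Paths.

(** * Drifts of the elastic particle system *)

(** The witness, the inverse of 4 plus the sum of all inverses, also makes sense for an empty
    family. The bound [4^-1] is used in [span_le_energy]. *)
Lemma finite_positive_lower_bound {R : realFieldType} {I : finType} (Q : pred I)
    (F : I -> R) : (forall i, Q i -> 0 < F i) ->
  exists e, [/\ 0 < e, e <= 4^-1 & forall i, Q i -> e <= F i].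
Proof.
move=> F0; pose s := \sum_(i | Q i) (F i)^-1.
have s0 : 0 <= s by apply: sumr_ge0 => i Qi; rewrite invr_ge0 ltW// F0.
have s4 : 0 < 4 + s by lra.
exists (4 + s)^-1; split; first by rewrite invr_gt0.
  by rewrite lef_pV2 ?posrE//; lra.
move=> i Qi; rewrite -[leRHS]invrK lef_pV2 ?posrE ?invr_gt0 ?F0//.
have sE : s = (F i)^-1 + \sum_(j | Q j && (j != i)) (F j)^-1 by rewrite /s
  (bigD1 i).
have : 0 <= \sum_(j | Q j && (j != i)) (F j)^-1.
  by apply: sumr_ge0 => j /andP[Qj _]; rewrite invr_ge0 ltW// F0.
by rewrite sE; lra.
Qed.

(** [expR y] is at most [1 / (1 - y)], and [(1 + y + 2 y^2) (1 - y) = 1 + y^2 (1 - 2 y)] is at least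
    one. *)
Lemma expR_le_quadratic {R : realType} (y : R) : y <= 2^-1 ->
  expR y <= 1 + y + 2 * y ^+ 2.
Proof.
move=> y2; have y1 : 0 < 1 - y by lra.
have h : expR y * (1 - y) <= 1.
  rewrite -[leRHS](expRxMexpNx_1 y).
  by apply: ler_wpM2l; [exact: expR_ge0|exact: expR_ge1Dx].
rewrite -(ler_pM2r y1); apply: (le_trans h).
have : 0 <= y ^+ 2 * (1 - 2 * y) by rewrite mulr_ge0 ?sqr_ge0//; lra.
by nra.
Qed.

Lemma abel_summation {R : comPzRingType} (v x : nat -> R) (n : nat) :
  \sum_(i < n.+1) v i * x i =
  (\sum_(i < n.+1) v i) * x n -
  \sum_(k < n) (\sum_(i < k.+1) v i) * (x k.+1 - x k).
Proof.
elim: n => [|n IH]; first by rewrite !big_ord_recr !big_ord0 /=; ring.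
rewrite big_ord_recr IH /= [X in _ = X * _ - _]big_ord_recr /=.
by rewrite [X in _ = _ - X]big_ord_recr /=; ring.
Qed.

(** * Transfer of pushes within a site, and the jump channels of the system *)

Section Elastic.
Context {R : realType} {n : nat} {m a b : 'I_n.+1 -> R}.
Hypotheses (hm : forall i, 0 < m i) (ha : forall i, 0 <= a i)
  (hb : forall i, 0 <= b i).
Implicit Types (x : config n) (i j k : 'I_n.+1) (y : {ffun 'I_n.+1 -> int}).

Lemma config_le x i j : (i <= j)%N -> x i <= x j.
Proof.
by move=> ij; have /forallP/(_ i)/forallP/(_ j)/implyP := positions_ordered x;
  apply.
Qed.

(* rho j is the last particle sharing the site of j: it receives its pushes. *)
Lemma sum_rateB x : exists rho : 'I_n.+1 -> 'I_n.+1,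
  [/\ forall j, (j <= rho j)%N, forall j, x (rho j) = x j &
   forall g : 'I_n.+1 -> R,
   \sum_i m i * rateB m b x i * g i = \sum_j m j * b j * g (rho j)].
Proof.
pose rho j := [arg max_(i > j | x i == x j) (i : nat)]%N.
have rhoP j : [/\ (j <= rho j)%N, x (rho j) = x j &
    forall i, x i = x j -> (i <= rho j)%N].
  rewrite /rho; case: arg_maxnP => [|i /eqP xi H]; first exact: eqxx.
  by split => [|//|k xk]; apply: H; rewrite ?xk.
(* Among the particles at the site of [j], only the last one is free to move right. *)
have key i j : right_free x i && (j <= i)%N && (x j == x i) = (i == rho j).
  have [r1 r2 r3] := rhoP j; apply/idP/eqP => [/andP[/andP[rf ji] /eqP xji]|->].
    have := r3 i (esym xji); rewrite leq_eqVlt => /orP[/eqP/val_inj//|irho].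
    have h : (i.+1 < n.+1)%N by apply: leq_ltn_trans (ltn_ord (rho j)).
    have := forallP rf (Ordinal h) => /implyP/(_ (eqxx _)).
    have := @config_le x (Ordinal h) (rho j) irho.
    by rewrite r2 xji => h1 h2; have := lt_le_trans h2 h1; rewrite ltxx.
  rewrite r1 r2 eqxx !andbT; apply/forallP => k; apply/implyP => /eqP kE.
  rewrite lt_neqAle config_le ?kE// andbT r2; apply/eqP => /esym/r3.
  by rewrite kE ltnn.
exists rho; split; [by move=> j; have [] := rhoP j|by move=> j;
  have [] := rhoP j|].
move=> g.
transitivity (\sum_i \sum_j m j * b j * ((i == rho j)%:R * g i)).
  apply: eq_bigr => i _; rewrite /rateB mulrA mulr_sumr mulr_suml big_mkcond /=.
  apply: eq_bigr => j _; rewrite -key.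
  have mi : m i != 0 by rewrite gt_eqF.
  case: (right_free x i); case: (j <= i)%N; case: (x j == x i) => /=;
    field => //.
rewrite exchange_big/=; apply: eq_bigr => j _.
rewrite -mulr_sumr (bigD1 (rho j))//= eqxx mul1r big1 ?addr0// => i /negbTE ->.
by rewrite mul0r.
Qed.

(** Mirror image of the previous identity: [rho j] is now the first particle at the site of [j]. *)
Lemma sum_rateA x : exists rho : 'I_n.+1 -> 'I_n.+1,
  [/\ forall j, (rho j <= j)%N, forall j, x (rho j) = x j &
   forall g : 'I_n.+1 -> R,
   \sum_i m i * rateA m a x i * g i = \sum_j m j * a j * g (rho j)].
Proof.
pose rho j := [arg min_(i < j | x i == x j) (i : nat)]%N.
have rhoP j : [/\ (rho j <= j)%N, x (rho j) = x j &
    forall i, x i = x j -> (rho j <= i)%N].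
  rewrite /rho; case: arg_minnP => [|i /eqP xi H]; first exact: eqxx.
  by split => [|//|k xk]; apply: H; rewrite ?xk.
have key i j : left_free x i && (i <= j)%N && (x j == x i) = (i == rho j).
  have [r1 r2 r3] := rhoP j; apply/idP/eqP => [/andP[/andP[lf ij] /eqP xji]|->].
    have := r3 i (esym xji); rewrite leq_eqVlt => /orP[/eqP/val_inj//|irho].
    have h : (i.-1 < n.+1)%N by apply: leq_ltn_trans (leq_pred _) (ltn_ord i).
    have iE : i.-1.+1 = i by rewrite prednK// (leq_ltn_trans _ irho).
    have := forallP lf (Ordinal h) => /implyP; rewrite /= iE => /(_ (eqxx _)).
    have := @config_le x (rho j) (Ordinal h); rewrite /= -ltnS iE => /(_ irho).
    by rewrite r2 xji => h1 h2; have := lt_le_trans h2 h1; rewrite ltxx.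
  rewrite r1 r2 eqxx !andbT; apply/forallP => k; apply/implyP => /eqP kE.
  rewrite lt_neqAle config_le -?kE// andbT r2; apply/eqP => /r3.
  by rewrite -kE ltnn.
exists rho; split; [by move=> j; have [] := rhoP j|by move=> j;
  have [] := rhoP j|].
move=> g.
transitivity (\sum_i \sum_j m j * a j * ((i == rho j)%:R * g i)).
  apply: eq_bigr => i _; rewrite /rateA mulrA mulr_sumr mulr_suml big_mkcond /=.
  apply: eq_bigr => j _; rewrite -key.
  have mi : m i != 0 by rewrite gt_eqF.
  case: (left_free x i); case: (i <= j)%N; case: (x j == x i) => /=;
    field => //.
rewrite exchange_big/=; apply: eq_bigr => j _.
rewrite -mulr_sumr (bigD1 (rho j))//= eqxx mul1r big1 ?addr0// => i /negbTE ->.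
by rewrite mul0r.
Qed.

Lemma rateA_ge0 x i : 0 <= rateA m a x i.
Proof.
rewrite mulr_ge0// sumr_ge0// => j _.
by rewrite !mulr_ge0 ?invr_ge0 ?(ltW (hm _)).
Qed.

Lemma rateB_ge0 x i : 0 <= rateB m b x i.
Proof.
rewrite mulr_ge0// sumr_ge0// => j _.
by rewrite !mulr_ge0 ?invr_ge0 ?(ltW (hm _)).
Qed.

(** By [mass_rates], the mass-weighted total jump rate, the same in all configurations. *)
Definition activity : R := \sum_j m j * (a j + b j).

Lemma mass_rates x :
  \sum_i m i * (rateA m a x i + rateB m b x i) = activity.
Proof.
have [rB [_ _ /(_ (fun=> 1)) EB]] := sum_rateB x.
have [rA [_ _ /(_ (fun=> 1)) EA]] := sum_rateA x.
under eq_bigr do rewrite mulrDr.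
rewrite big_split/= /activity.
under [RHS]eq_bigr do rewrite mulrDr.
rewrite big_split/=; congr (_ + _).
  by under eq_bigr do rewrite -[_ * _]mulr1; rewrite EA; apply: eq_bigr => j _;
    rewrite mulr1.
by under eq_bigr do rewrite -[_ * _]mulr1; rewrite EB; apply: eq_bigr => j _;
  rewrite mulr1.
Qed.

Definition elastic_rate x (e : 'I_n.+1 * bool) : R :=
  if e.2 then rateB m b x e.1 else rateA m a x e.1.

(** [insubd] falls back on [x] if the shifted positions are not ordered; by [elastic_targetE] this
    happens only at rate zero. *)
Definition elastic_target x (e : 'I_n.+1 * bool) : config n :=
  insubd x (shift_particle x e.1 (if e.2 then 1 else -1)).

Lemma sum_jumps (F : 'I_n.+1 * bool -> R) :
  \sum_e F e = \sum_i (F (i, true) + F (i, false)).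
Proof.
rewrite (eq_bigr (fun e => F (e.1, e.2))); last by case.
rewrite -(pair_bigA _ (fun i e => F (i, e))) /=.
by apply: eq_bigr => i _; rewrite big_bool.
Qed.

(** A nonzero rate means that the particle is free on the side of the jump: its neighbour there is
    at least one site away, so the order survives. *)
Lemma elastic_targetE x i (e : bool) : elastic_rate x (i, e) != 0 ->
  positions (elastic_target x (i,
    e)) = shift_particle x i (if e then 1 else -1).
Proof.
move=> r0; rewrite /elastic_target /= -[LHS]/(val (insubd x _)) val_insubd.
rewrite ifT//; apply/forallP => j; apply/forallP => k; apply/implyP => jk.
rewrite !ffunE; have xjk := config_le x j k jk.
move: r0; rewrite /elastic_rate /=; case: e.
  rewrite /rateB; have [rf _|_] := boolP (right_free x i);
    last by rewrite mul0r eqxx.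
  case: (eqVneq j i) => [ji|_]; case: (eqVneq k i) => [ki|ki] //; try lia.
  have ik : (i < k)%N.
    have ik : (i <= k)%N by rewrite -ji.
    by rewrite ltn_neqAle ik andbT; apply/eqP => /val_inj E;
      rewrite E eqxx in ki.
  have h : (i.+1 < n.+1)%N by apply: leq_ltn_trans (ltn_ord k).
  have := forallP rf (Ordinal h) => /implyP/(_ (eqxx _)).
  by have := config_le x (Ordinal h) k ik; rewrite ji; lia.
rewrite /rateA; have [lf _|_] := boolP (left_free x i);
  last by rewrite mul0r eqxx.
case: (eqVneq j i) => [ji|ji]; case: (eqVneq k i) => [ki|ki] //; try lia.
have ji' : (j < i)%N.
  have ji' : (j <= i)%N by rewrite -ki.
  by rewrite ltn_neqAle ji' andbT; apply/eqP => /val_inj E;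
    rewrite E eqxx in ji.
have h : (i.-1 < n.+1)%N by apply: leq_ltn_trans (leq_pred _) (ltn_ord i).
have iE : i.-1.+1 = i by rewrite prednK// (leq_ltn_trans _ ji').
have := forallP lf (Ordinal h) => /implyP; rewrite /= iE => /(_ (eqxx _)).
have := config_le x j (Ordinal h); rewrite /= -ltnS iE => /(_ ji').
by rewrite ki; lia.
Qed.

(** The generator applied to [F]. Test functions are defined on all integer vectors, so that
    [driftE] can evaluate them at plain shifts. *)
Definition drift (F : {ffun 'I_n.+1 -> int} -> R) x : R :=
  \sum_e elastic_rate x e * (F (elastic_target x e) - F x).

Lemma driftE F x : drift F x =
  \sum_i (rateB m b x i * (F (shift_particle x i 1) - F x)
        + rateA m a x i * (F (shift_particle x i (-1)) - F x)).
Proof.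
rewrite /drift sum_jumps; apply: eq_bigr => i _; congr (_ + _).
  have [E|/elastic_targetE ->//] := eqVneq (elastic_rate x (i, true)) 0.
  by rewrite E mul0r; move: E; rewrite /elastic_rate /= => ->; rewrite mul0r.
have [E|/elastic_targetE ->//] := eqVneq (elastic_rate x (i, false)) 0.
by rewrite E mul0r; move: E; rewrite /elastic_rate /= => ->; rewrite mul0r.
Qed.

Lemma elastic_rate_ge0 x e : 0 <= elastic_rate x e.
Proof. by rewrite /elastic_rate; case: e.2; rewrite ?rateA_ge0 ?rateB_ge0. Qed.

Lemma activity_ge0 : 0 <= activity.
Proof. by apply: sumr_ge0 => j _; rewrite mulr_ge0 ?addr_ge0// ltW. Qed.

Lemma elastic_jump_generator (mu : R) : 0 < mu -> (forall i, mu <= m i) ->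
  jump_generator (Qmatrix m a b) elastic_rate elastic_target (activity / mu).
Proof.
move=> mu0 hmu; split; first exact: elastic_rate_ge0.
  move=> x; rewrite ler_pdivlMr// -(mass_rates x) sum_jumps mulr_suml.
  apply: ler_sum => i _; rewrite mulrC /elastic_rate /= [X in _ * X <= _]addrC.
  by rewrite ler_wpM2r// addr_ge0// ?rateA_ge0 ?rateB_ge0.
move=> x y; under [RHS]eq_bigr do rewrite mulrBr.
rewrite sumrB -mulr_suml /Qmatrix [_%:R * _]mulrC; congr (_ - _ * _).
  rewrite sum_jumps; apply: eq_bigr => i _; rewrite addrC; congr (_ + _).
    have [E|/elastic_targetE E] := eqVneq (elastic_rate x (i, true)) 0.
      by rewrite E; move: E; rewrite /elastic_rate /= => ->; rewrite !mul0r.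
    by rewrite -E eq_sym.
  have [E|/elastic_targetE E] := eqVneq (elastic_rate x (i, false)) 0.
    by rewrite E; move: E; rewrite /elastic_rate /= => ->; rewrite !mul0r.
  by rewrite -E eq_sym.
by rewrite sum_jumps; apply: eq_bigr => i _; rewrite addrC.
Qed.

End Elastic.

Arguments activity {R n} m a b.
Arguments elastic_rate {R n} m a b.
Arguments elastic_target {n}.
Arguments drift {R n} m a b F x.

(** * Linear functionals of a configuration and its span *)

Section LinearFunctionals.
Context {R : realType} {n : nat}.
Implicit Types (w v : 'I_n.+1 -> R) (x : config n) (y : {ffun 'I_n.+1 -> int})
  (i j k : 'I_n.+1).

Definition lin w y : R := \sum_i w i * (y i)%:~R.

Definition spanR x : R := (config_span x)%:~R.

Lemma spanRE x : spanR x = (x ord_max)%:~R - (x ord0)%:~R.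
Proof. by rewrite /spanR /config_span rmorphB. Qed.

Lemma config_leR x i j : (i <= j)%N -> (x i)%:~R <= (x j)%:~R :> R.
Proof. by move=> ij; rewrite ler_int config_le. Qed.

Lemma spanR_ge0 x : 0 <= spanR x.
Proof. by rewrite spanRE subr_ge0 config_leR. Qed.

Lemma lin_shift w x i (e : int) :
  lin w (shift_particle x i e) = lin w x + w i * e%:~R.
Proof.
rewrite /lin; under eq_bigr do rewrite ffunE rmorphD mulrDr.
rewrite big_split/=; congr (_ + _);
  rewrite (bigD1 i)//= eqxx big1 ?addr0// => j ji.
by rewrite (negbTE ji) mulr0.
Qed.

(** By Abel summation the left side is minus the sum of prefix sums times gaps; the gaps are
    nonnegative and add up to the span. *)
Lemma prefix_sums_le_span v (e : R) x :
  (forall k, (k < n)%N -> e <= \sum_(i < n.+1 | (i <= k)%N) v i) ->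
  \sum_i v i = 0 -> \sum_i v i * (x i)%:~R <= - e * spanR x.
Proof.
move=> ve v0.
pose v' (i : nat) := v (inord i); pose x' (i : nat) : R := (x (inord i))%:~R.
have E (F : 'I_n.+1 -> R) : \sum_i F i = \sum_(i < n.+1) F (inord i).
  by apply: eq_bigr => i _; rewrite inord_val.
rewrite E (abel_summation v' x' n) -(E v) v0 mul0r sub0r mulNr lerN2 spanRE.
have -> : (x ord_max)%:~R - (x ord0)%:~R = \sum_(k < n) (x' k.+1 - x' k).
  rewrite -(big_mkord xpredT (fun k : nat => x' k.+1 - x' k)) telescope_sumr//.
  by congr ((x _)%:~R - (x _)%:~R); apply: val_inj; rewrite /= inordK.
rewrite mulr_sumr; apply: ler_sum => k _; apply: ler_wpM2r.
  have kn := ltn_ord k.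
  by rewrite subr_ge0; apply: config_leR; rewrite !inordK// ltnW.
have kn := ltn_ord k.
have := ve (inord k); rewrite inordK; last exact: ltnW.
move=> /(_ kn)/le_trans; apply.
rewrite (big_ord_widen n.+1 v' (leqW kn)).
rewrite le_eqVlt; apply/orP; left; apply/eqP; apply: eq_big => i //;
  by rewrite /v' inord_val.
Qed.

End LinearFunctionals.

(** * Conservation laws and the exponential drift of the momentum *)

Section Drifts.
Context {R : realType} {n : nat} {m a b : 'I_n.+1 -> R}.
Hypotheses (hm : forall i, 0 < m i) (ha : forall i, 0 <= a i)
  (hb : forall i, 0 <= b i).
Implicit Types (x : config n) (i j k : 'I_n.+1) (y : {ffun 'I_n.+1 -> int}).

Let A0 x i : 0 <= rateA m a x i. Proof. exact: rateA_ge0. Qed.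
Let B0 x i : 0 <= rateB m b x i. Proof. exact: rateB_ge0. Qed.

Lemma Usum_max : Usum m a b ord_max = - \sum_i m i * (b i - a i).
Proof. by congr (- _); apply: eq_bigl => i; rewrite -ltnS ltn_ord. Qed.

Lemma Msum_max : Msum m ord_max = \sum_i m i.
Proof. by apply: eq_bigl => i; rewrite -ltnS ltn_ord. Qed.

Lemma Msum_gt0 k : 0 < Msum m k.
Proof.
rewrite /Msum (bigD1 k)//=; apply: ltr_pwDl => //.
by apply: sumr_ge0 => i _; exact: ltW.
Qed.

Lemma mass_le_Msum i : m i <= Msum m ord_max.
Proof.
rewrite Msum_max (bigD1 i)//= lerDl.
by apply: sumr_ge0 => j _; exact: ltW.
Qed.

Lemma mass_flux x :
  \sum_i m i * (rateB m b x i - rateA m a x i) = - Usum m a b ord_max.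
Proof.
rewrite Usum_max opprK.
have [rB [_ _ /(_ (fun=> 1)) EB]] := sum_rateB (b := b) hm x.
have [rA [_ _ /(_ (fun=> 1)) EA]] := sum_rateA (a := a) hm x.
under eq_bigr do rewrite mulrBr -[_ * rateB _ _ _ _]mulr1 -[_ * rateA _ _ _
  _]mulr1.
rewrite sumrB EA EB -sumrB; apply: eq_bigr => i _; ring.
Qed.

(** A push is handed over to a particle at the same site, so the position at which it acts is
    unchanged. *)
Lemma position_flux x :
  \sum_i m i * (rateB m b x i - rateA m a x i) * (x i)%:~R =
  \sum_i m i * (b i - a i) * (x i)%:~R.
Proof.
have [rB [_ xB /(_ (fun i => (x i)%:~R)) EB]] := sum_rateB (b := b) hm x.
have [rA [_ xA /(_ (fun i => (x i)%:~R)) EA]] := sum_rateA (a := a) hm x.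
under eq_bigr do rewrite mulrBr mulrBl.
rewrite sumrB EA EB -sumrB; apply: eq_bigr => i _; rewrite xA xB; ring.
Qed.

(** Pushes to the right are handed to larger or equal indices and may leave the prefix; pushes to
    the left are handed to smaller or equal indices and may enter it. Both effects lower the
    flux. *)
Lemma prefix_flux x k :
  \sum_(i < n.+1 | (i <= k)%N) m i * (rateB m b x i - rateA m a x i) <=
  - Usum m a b k.
Proof.
pose g (i : 'I_n.+1) : R := (i <= k)%N%:R.
have [rB [hB _ /(_ g) EB]] := sum_rateB (b := b) hm x.
have [rA [hA _ /(_ g) EA]] := sum_rateA (a := a) hm x.
rewrite /Usum opprK.
have ind (F : 'I_n.+1 -> R) : \sum_(i < n.+1 | (i <= k)%N) F i = \sum_i F i * g
  i.
  rewrite big_mkcond; apply: eq_bigr => i _; rewrite /g.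
  by case: ifP => _; rewrite ?mulr1 ?mulr0.
rewrite !ind; under eq_bigr do rewrite mulrBr mulrBl.
under [leRHS]eq_bigr do rewrite mulrBr mulrBl.
rewrite !sumrB EA EB lerB//; apply: ler_sum => i _; apply: ler_wpM2l.
- by rewrite mulr_ge0// ltW.
- rewrite /g; case: (boolP (rB i <= k)%N) => [h|_] /=; last exact: ler0n.
  by rewrite (leq_trans (hB i) h).
- by rewrite mulr_ge0// ltW.
- rewrite /g; case: (boolP (i <= k)%N) => [h|_] /=; last exact: ler0n.
  by rewrite (leq_trans (hA i) h).
Qed.

(** Each jump changes [lin m] by plus or minus [m i]. Expanding the exponential to second order, the
    linear terms sum to the constant mass flux and the squares, with one factor [m i] bounded by the
    total mass, to [activity]. *)
Lemma exponential_drift (theta : R) x : `|theta| * Msum m ord_max <= 2^-1 ->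
  drift m a b (fun y => expR (theta * lin m y)) x <=
  (theta * - Usum m a b ord_max
    + 2 * theta ^+ 2 * (Msum m ord_max * activity m a b))
  * expR (theta * lin m x).
Proof.
move=> tM; rewrite driftE.
have E i (e : int) : expR (theta * lin m (shift_particle x i e)) - expR (theta
  * lin m x)
    = expR (theta * lin m x) * (expR (theta * (m i * e%:~R)) - 1).
  by rewrite lin_shift mulrDr expRD; ring.
have tm i : `|theta * m i| <= 2^-1.
  rewrite normrM (gtr0_norm (hm i)); apply: le_trans tM.
  by rewrite ler_wpM2l// mass_le_Msum.
rewrite [leRHS]mulrC; under eq_bigr do rewrite /= !E.
under eq_bigr => i _.
  rewrite (_ : _ + _ = expR (theta * lin m x) * (rateB m b x i * (expR (theta *
    (m i * 1%:~R)) - 1)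
    + rateA m a x i * (expR (theta * (m i * (-1)%:~R)) - 1))); last by ring.
  over.
rewrite -mulr_sumr ler_wpM2l ?expR_ge0//.
apply: (@le_trans _ _ (\sum_i (theta * (m i * (rateB m b x i - rateA m a x i)) +
   2 * theta ^+ 2 * (Msum m ord_max * (m i * (rateA m a x i + rateB m b x
     i)))))).
  apply: ler_sum => i _.
  have /andP[t1 t2] : - 2^-1 <= theta * m i <= 2^-1 by rewrite -ler_norml.
  have q1 := @expR_le_quadratic R (theta * m i) t2.
  have q2 := @expR_le_quadratic R (- (theta * m i)).
  have -> : theta * (m i * (-1)%:~R) = - (theta * m i) by rewrite mulrN1z; ring.
  rewrite mulr1.
  have q2' : expR (- (theta * m i)) - 1 <= - (theta * m i) + 2 * (theta * m i)
    ^+ 2.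
    have /q2 : - (theta * m i) <= 2^-1 by lra.
    by rewrite sqrrN; lra.
  have q1' : expR (theta * m i) - 1 <= theta * m i + 2 * (theta * m i) ^+ 2 by
    lra.
  have p1 := ler_wpM2l (B0 x i) q1'; have p2 := ler_wpM2l (A0 x i) q2'.
  apply: (le_trans (lerD p1 p2)).
  have : theta ^+ 2 * (m i * m i * (rateA m a x i + rateB m b x i)) <=
    theta ^+ 2 * (Msum m ord_max * m i * (rateA m a x i + rateB m b x i)).
    apply: ler_wpM2l; first exact: sqr_ge0.
    apply: ler_wpM2r; first by rewrite addr_ge0.
    by apply: ler_wpM2r; [exact: ltW|exact: mass_le_Msum].
  by rewrite !expr2; lra.
by rewrite big_split/= -!mulr_sumr mass_flux mass_rates.
Qed.

End Drifts.

(** * Energy, spread and the exponential Lyapunov function *)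

Section Lyapunov.
Context {R : realType} {n : nat} {m a b : 'I_n.+1 -> R}.
Hypotheses (hm : forall i, 0 < m i) (ha : forall i, 0 <= a i)
  (hb : forall i, 0 <= b i).
Implicit Types (x : config n) (i j k l : 'I_n.+1) (y : {ffun 'I_n.+1 -> int}).

Let A0 x i : 0 <= rateA m a x i. Proof. exact: rateA_ge0. Qed.
Let B0 x i : 0 <= rateB m b x i. Proof. exact: rateB_ge0. Qed.

Local Notation M := (Msum m ord_max).
Local Notation U := (Usum m a b ord_max).

Let M0 : 0 < M. Proof. exact: Msum_gt0. Qed.

Lemma Msum_le k l : (k <= l)%N -> Msum m k <= Msum m l.
Proof.
move=> kl; rewrite /Msum [leRHS](bigID (fun i : 'I_n.+1 => (i <= k)%N)) /=.
rewrite [X in _ <= X + _](eq_bigl (fun i : 'I_n.+1 => (i <= k)%N)); last first.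
  by move=> i; case: (boolP (i <= k)%N) => [ik|];
    rewrite ?andbF//= (leq_trans ik kl).
by rewrite lerDl; apply: sumr_ge0 => i _; exact: ltW.
Qed.

Lemma lin_le_span (v : 'I_n.+1 -> R) x :
  (forall k, (k < n)%N -> -1 <= \sum_(i < n.+1 | (i <= k)%N) v i) ->
  \sum_i v i = 0 -> lin v x <= spanR x.
Proof. by move=> h v0; have := prefix_sums_le_span v (-1) x h v0;
  rewrite opprK mul1r. Qed.

(** The deviation from the centre of mass is a linear functional with total weight zero and prefix
    sums between -1 and 1; the sign [s] treats both bounds together. *)
Lemma deviation_le_span x i : `|(x i)%:~R - lin m x / M| <= spanR x.
Proof.
pose v (s : R) j : R := s * ((j == i)%:R - m j / M).
have vE s : lin (v s) x = s * ((x i)%:~R - lin m x / M).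
  rewrite /lin /v; under eq_bigr do rewrite -mulrA mulrBl.
  rewrite -mulr_sumr sumrB; congr (_ * (_ - _)).
    by rewrite (bigD1 i)//= eqxx mul1r big1 ?addr0// => j /negbTE ->;
      rewrite mul0r.
  by rewrite mulr_suml; apply: eq_bigr => j _; rewrite mulrAC.
have pre s k : \sum_(j < n.+1 | (j <= k)%N) v s j = s * ((i <= k)%N%:R - Msum m
  k / M).
  rewrite /v -mulr_sumr sumrB -mulr_suml; congr (_ * (_ - _)).
  have [ik|ik] := boolP (i <= k)%N.
    by rewrite (bigD1 i)//= eqxx big1 ?addr0// => j /andP[_ /negbTE ->].
  by rewrite big1// => j jk; case: eqVneq => // ji; rewrite -ji jk in ik.
have tot s : \sum_j v s j = 0.
  rewrite (eq_bigl (fun j : 'I_n.+1 => (j <= @ord_max n)%N)); last by move=> j;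
    rewrite -ltnS ltn_ord.
  by rewrite pre -ltnS ltn_ord divff ?gt_eqF// subrr mulr0.
have bnd k : 0 <= Msum m k / M <= 1.
  by rewrite divr_ge0 ?(ltW (Msum_gt0 hm _))//= ler_pdivrMr// mul1r Msum_le//
    -ltnS.
rewrite ler_norml lerNl; apply/andP; split.
  rewrite -mulN1r -vE; apply: lin_le_span => // k _; rewrite pre.
  by have /andP[] := bnd k; case: (i <= k)%N => /=; lra.
rewrite -[X in X <= _]mul1r -vE; apply: lin_le_span => // k _; rewrite pre.
by have /andP[] := bnd k; case: (i <= k)%N => /=; lra.
Qed.

(** The second moment about the centre of mass ([energyE]), in the expanded form that makes the
    effect of a shift explicit. *)
Definition energy y : R :=
  \sum_i m i * (y i)%:~R ^+ 2 - lin m y ^+ 2 / M.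

Lemma energyE y : energy y = \sum_i m i * ((y i)%:~R - lin m y / M) ^+ 2.
Proof.
under [RHS]eq_bigr => i _.
  rewrite (_ : _ * _ = m i * (y i)%:~R ^+ 2 - 2 * (lin m y / M) * (m i * (y
    i)%:~R) +
    (lin m y / M) ^+ 2 * m i); last by ring.
  over.
rewrite big_split sumrB/= -!mulr_sumr -/(lin m y) -(Msum_max (m := m)) /energy.
by field; rewrite gt_eqF.
Qed.

Lemma energy_ge0 y : 0 <= energy y.
Proof.
by rewrite energyE sumr_ge0// => i _; rewrite mulr_ge0 ?sqr_ge0// ltW.
Qed.

Lemma energy_le x : energy x <= M * spanR x ^+ 2.
Proof.
rewrite energyE [X in _ <= X * _]Msum_max [leRHS]mulr_suml;
  apply: ler_sum => i _.
rewrite ler_wpM2l ?(ltW (hm i))// -[leLHS]real_normK ?num_real//.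
rewrite lerXn2r ?nnegrE ?spanR_ge0//; exact: deviation_le_span.
Qed.

(** Comparing both extreme particles with the centre of mass bounds [c] times the squared span by
    four times the energy; [c <= 4^-1] absorbs the four. *)
Lemma span_le_energy x (c : R) : 0 < c -> c <= 4^-1 -> (forall i, c <= m i) ->
  (c * spanR x) ^+ 2 <= energy x.
Proof.
move=> c0 c4 cm.
have one i : c * ((x i)%:~R - lin m x / M) ^+ 2 <= energy x.
  rewrite energyE (bigD1 i)//=.
  apply: (@le_trans _ _ (m i * ((x i)%:~R - lin m x / M) ^+ 2)).
    by rewrite ler_wpM2r ?sqr_ge0.
  by rewrite lerDl sumr_ge0// => j _; rewrite mulr_ge0 ?sqr_ge0// ltW.
have := one ord_max; have := one ord0.
rewrite spanRE; move: (lin m x / M) (_%:~R) (_%:~R) => s u v h1 h2.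
have : c * (c * (v - u) ^+ 2) <= 4^-1 * (c * (v - u) ^+ 2).
  by rewrite ler_wpM2r// mulr_ge0 ?sqr_ge0// ltW.
have : 0 <= c * (v - s + (u - s)) ^+ 2 by rewrite mulr_ge0 ?sqr_ge0// ltW.
by lra.
Qed.

Lemma energy_shift x i (e : int) :
  energy (shift_particle x i e) - energy x =
  m i * (2 * (x i)%:~R * e%:~R + e%:~R ^+ 2)
  - (2 * lin m x * (m i * e%:~R) + (m i * e%:~R) ^+ 2) / M.
Proof.
rewrite /energy lin_shift.
have -> : \sum_j m j * (shift_particle x i e j)%:~R ^+ 2 =
    \sum_j m j * (x j)%:~R ^+ 2 + m i * (2 * (x i)%:~R * e%:~R + e%:~R ^+ 2) :>
      R.
  rewrite (bigD1 i)//= [in RHS](bigD1 i)//= ffunE eqxx rmorphD/=.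
  rewrite (eq_bigr (fun j => m j * (x j)%:~R ^+ 2)); first by ring.
  by move=> j /negbTE ji; rewrite ffunE ji addr0.
by field; rewrite gt_eqF.
Qed.

(** The linear terms are exact by the two conservation laws. Of the second-order weights
    [m i * (1 - m i / M)] only the negative part is dropped, which leaves [activity]. *)
Lemma energy_drift x : drift m a b energy x <=
  2 * lin (fun i => m i * (b i - a i + U / M)) x + activity m a b.
Proof.
rewrite driftE.
apply: (@le_trans _ _ (\sum_i (2 * (m i * (rateB m b x i - rateA m a x i) * (x
  i)%:~R)
  - 2 * (lin m x / M) * (m i * (rateB m b x i - rateA m a x i))
  + m i * (rateA m a x i + rateB m b x i)))).
  apply: ler_sum => i _; rewrite !energy_shift mulrN1z.
  have : 0 <= m i ^+ 2 / M * (rateA m a x i + rateB m b x i).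
    by rewrite mulr_ge0 ?addr_ge0 ?divr_ge0 ?sqr_ge0// ltW.
  rewrite (_ : (1%:~R : R) = 1)//.
  rewrite -subr_ge0 => h; rewrite -subr_ge0; apply: le_trans h _.
  by rewrite le_eqVlt; apply/orP; left; apply/eqP; field; rewrite gt_eqF.
rewrite big_split sumrB/= -!mulr_sumr mass_flux// position_flux// mass_rates//.
have -> : lin (fun i => m i * (b i - a i + U / M)) x =
    \sum_i m i * (b i - a i) * (x i)%:~R + U / M * lin m x.
  rewrite [X in _ = _ + X]mulr_sumr -big_split; apply: eq_bigr => i _ /=; ring.
rewrite lerD2r le_eqVlt; apply/orP; left; apply/eqP.
by field; rewrite gt_eqF.
Qed.

(** Comparable to the span, but with bounded increments and an explicit drift; the added one allows
    division by it. *)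
Definition spread y : R := Num.sqrt (1 + energy y).

Lemma spread_sqr y : spread y ^+ 2 = 1 + energy y.
Proof. by rewrite sqr_sqrtr// addr_ge0 ?energy_ge0. Qed.

Lemma spread_ge1 y : 1 <= spread y.
Proof.
by rewrite -[leLHS]sqrtr1; apply: ler_wsqrtr; rewrite lerDl energy_ge0.
Qed.

Lemma spread_upper x : spread x <= 1 + (1 + M) * spanR x.
Proof.
have d0 := spanR_ge0 (R := R) x.
have h0 : 0 <= (1 + M) * spanR x by rewrite mulr_ge0// addr_ge0// ltW.
rewrite -[leRHS]ger0_norm ?addr_ge0// -sqrtr_sqr; apply: ler_wsqrtr.
have := energy_le x.
have : 0 <= M * spanR x ^+ 2 by rewrite mulr_ge0 ?sqr_ge0// ltW.
have : 0 <= M * (M * spanR x ^+ 2) by rewrite !mulr_ge0 ?sqr_ge0// ltW.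
have := sqr_ge0 (spanR x : R); have : 0 <= M * spanR x by rewrite mulr_ge0//
  ltW.
by lra.
Qed.

Lemma spread_lower x (c : R) : 0 < c -> c <= 4^-1 -> (forall i, c <= m i) ->
  c * spanR x <= spread x.
Proof.
move=> c0 c4 cm; have d0 := spanR_ge0 (R := R) x.
have h0 : 0 <= c * spanR x by rewrite mulr_ge0// ltW.
rewrite -[leLHS]ger0_norm// -sqrtr_sqr; apply: ler_wsqrtr.
by apply: (le_trans (span_le_energy x c c0 c4 cm)); rewrite lerDr.
Qed.

(* Concavity of the square root. *)
Lemma spread_increment y y' :
  spread y' - spread y <= (energy y' - energy y) / (2 * spread y).
Proof.
have y1 := spread_ge1 y; rewrite ler_pdivlMr ?mulr_gt0//; last by lra.
have := spread_sqr y; have := spread_sqr y';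
  have := sqr_ge0 (spread y' - spread y).
by nra.
Qed.

(** One jump changes the energy by at most a constant times the spread; factoring the difference of
    squares divides this by at least [spread x]. *)
Lemma spread_shift_bound x i (e : int) (c : R) : 0 < c -> c <= 4^-1 ->
  (forall j, c <= m j) -> `|e|%N = 1%N ->
  `|spread (shift_particle x i e) - spread x| <= 2 * M / c + M.
Proof.
move=> c0 c4 cm e1; set y := shift_particle x i e.
have L1 := spread_ge1 x; have L2 := spread_ge1 y.
have Lp : 0 < spread x by lra.
have H : `|energy y - energy x| <= (2 * M / c + M) * spread x.
  rewrite energy_shift.
  have er : `|(e%:~R : R)| = 1.
    by rewrite -intr_norm -abszE e1.
  have ee : (e%:~R : R) ^+ 2 = 1 by rewrite -[LHS]real_normK ?num_real// er
    expr1n.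
  rewrite (_ : _ - _ = 2 * m i * e%:~R * ((x i)%:~R - lin m x / M)
    + m i * e%:~R ^+ 2 * (1 - m i / M)); last by field; rewrite gt_eqF.
  rewrite ee mulr1; apply: (le_trans (ler_normD _ _)).
  have mM := mass_le_Msum hm i; have mi0 := ltW (hm i).
  have q1 : 0 <= m i / M by rewrite divr_ge0// ltW.
  have q2 : m i / M <= 1 by rewrite ler_pdivrMr// mul1r.
  have n1 : `|m i * (1 - m i / M)| <= M * spread x.
    rewrite ger0_norm; last by rewrite mulr_ge0// subr_ge0.
    by apply: ler_pM => //; rewrite ?subr_ge0//; lra.
  have n2 : `|2 * m i * e%:~R * ((x i)%:~R - lin m x / M)| <= 2 * M / c *
    spread x.
    rewrite !normrM er mulr1 normr_nat (gtr0_norm (hm i)) -!mulrA.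
    rewrite ler_wpM2l//; apply: ler_pM => //.
    rewrite [leRHS]mulrC ler_pdivlMr// [leLHS]mulrC.
    apply: le_trans (spread_lower x c c0 c4 cm); rewrite ler_wpM2l ?(ltW c0)//.
    exact: deviation_le_span.
  by rewrite [leRHS]mulrDl lerD.
rewrite -(ler_pM2r Lp); apply: le_trans H.
have -> : energy y - energy x = (spread y - spread x) * (spread y + spread x).
  by have := spread_sqr x; have := spread_sqr y; nra.
rewrite normrM ler_wpM2l// ger0_norm; lra.
Qed.

(** The prefix sum up to [k] equals [Msum m k * (U / M) - Usum m a b k], which the cloud condition
    makes positive. *)
Lemma cloud_prefix_sums : cloud_condition m a b ->
  let v i := m i * (b i - a i + U / M) in
  \sum_i v i = 0 /\ exists e : R, 0 < e /\
  forall k, (k < n)%N -> e <= \sum_(i < n.+1 | (i <= k)%N) v i.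
Proof.
move=> cc v.
have pre k : \sum_(i < n.+1 | (i <= k)%N) v i = - Usum m a b k + Msum m k * (U
  / M).
  rewrite /v; under eq_bigr do rewrite mulrDr.
  by rewrite big_split/= -mulr_suml /Usum opprK.
split.
  rewrite (eq_bigl (fun j : 'I_n.+1 => (j <= @ord_max n)%N)); last by move=> j;
    rewrite -ltnS ltn_ord.
  by rewrite pre; field; rewrite gt_eqF.
have [k kn|e [e0 _ eP]] := @finite_positive_lower_bound R 'I_n.+1 (fun k =>
  (k < n)%N)
    (fun k => \sum_(i < n.+1 | (i <= k)%N) v i).
  rewrite pre addrC subr_gt0.
  have := cc k kn; rewrite ltr_pdivrMr ?Msum_gt0// => h; by rewrite mulrC.
by exists e.
Qed.

Lemma total_rate_le x (c : R) : 0 < c -> (forall i, c <= m i) ->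
  \sum_i (rateA m a x i + rateB m b x i) <= activity m a b / c.
Proof.
move=> c0 cm; rewrite ler_pdivlMr// -(mass_rates hm x) mulr_suml.
by apply: ler_sum => i _; rewrite mulrC ler_wpM2r// addr_ge0.
Qed.

(** Second-order expansion of the exponential: concavity of the square root replaces the linear part
    by the energy drift, and the jump bound [kappa] controls the quadratic part. *)
Lemma exponential_spread_drift (delta kappa Lam : R) x : 0 <= delta ->
  0 <= kappa -> delta * kappa <= 2^-1 ->
  (forall i (e : int), `|e|%N = 1%N ->
     `|spread (shift_particle x i e) - spread x| <= kappa) ->
  \sum_i (rateA m a x i + rateB m b x i) <= Lam ->
  drift m a b (fun y => expR (delta * spread y)) x <=
  expR (delta * spread x) * (delta * (drift m a b energy x / (2 * spread x))
     + 2 * (delta * kappa) ^+ 2 * Lam).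
Proof.
move=> d0 k0 dk hk hL.
have L1 := spread_ge1 x.
pose d (i : 'I_n.+1) (e : int) := energy (shift_particle x i e) - energy x.
have one i (e : int) : `|e|%N = 1%N ->
    expR (delta * spread (shift_particle x i e)) - expR (delta * spread x) <=
    expR (delta * spread x) * (delta * (d i e / (2 * spread x)) + 2 * (delta *
      kappa) ^+ 2).
  move=> e1; set z := spread (shift_particle x i e) - spread x.
  have zk := hk i e e1; rewrite -/z in zk.
  have -> : delta * spread (shift_particle x i e) = delta * spread x + delta *
    z.
    by rewrite /z; ring.
  rewrite expRD -[X in _ - X]mulr1 -mulrBr ler_wpM2l ?expR_ge0//.
  have dz : `|delta * z| <= delta * kappa by rewrite normrM (ger0_norm d0)
    ler_wpM2l.
  have dz2 : (delta * z) ^+ 2 <= (delta * kappa) ^+ 2.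
    by rewrite -[leLHS]real_normK ?num_real// lerXn2r ?nnegrE// mulr_ge0.
  have /expR_le_quadratic q : delta * z <= 2^-1.
    by apply: le_trans dk; apply: le_trans dz; exact: ler_norm.
  have := ler_wpM2l d0 (spread_increment x (shift_particle x i e)).
  rewrite -/(d i e) -/z => h; lra.
rewrite !driftE.
apply: (@le_trans _ _ (\sum_i (expR (delta * spread x) * (delta / (2 * spread
  x)) *
    (rateB m b x i * d i 1 + rateA m a x i * d i (-1)) +
    expR (delta * spread x) * (2 * (delta * kappa) ^+ 2) * (rateA m a x i +
      rateB m b x i)))).
  apply: ler_sum => i _ /=.
  have o1 := ler_wpM2l (B0 x i) (one i 1 erefl).
  have o2 := ler_wpM2l (A0 x i) (one i (-1) erefl).
  apply: (le_trans (lerD o1 o2)).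
  by rewrite le_eqVlt; apply/orP; left; apply/eqP; ring.
rewrite big_split/= -!mulr_sumr mulrDr lerD//.
  by rewrite le_eqVlt; apply/orP; left; apply/eqP; ring.
rewrite -mulrA; apply: ler_wpM2l; first exact: expR_ge0.
by apply: ler_wpM2l => //; rewrite mulr_ge0 ?sqr_ge0.
Qed.

Lemma cloud_lyapunov : cloud_condition m a b ->
  exists delta g K c C : R, [/\ [/\ 0 < delta, 0 < g, 0 <= K, 0 < c & 0 <= C],
    forall x, c * spanR x <= spread x, forall x, spread x <= 1 + C * spanR x &
    forall x, drift m a b (fun y => expR (delta * spread y)) x <=
      - g * expR (delta * spread x) + K].
Proof.
move=> cc; have [v0 [e [e0 he]]] := cloud_prefix_sums cc.
have [c [c0 c4 /(_ _ isT) cm]] := @finite_positive_lower_bound R 'I_n.+1 xpredT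
  m (fun i _ => hm i).
pose Lam := activity m a b / c; pose kappa := 2 * M / c + M.
have act0 : 0 <= activity m a b by exact: activity_ge0.
have Lam0 : 0 <= Lam by rewrite divr_ge0// ltW.
have kap0 : 0 <= kappa.
  by rewrite addr_ge0 ?(ltW M0)// divr_ge0 ?(ltW c0)// mulr_ge0// ltW.
have M1 : 0 < 1 + M by rewrite addr_gt0.
(* By [spread_upper], the energy drift is at most [- 2 * e2 * spread x + K1] for the [K1] below. *)
pose e2 := e / (1 + M).
have e20 : 0 < e2 by rewrite divr_gt0.
pose K1 := 2 * e2 + activity m a b.
have K10 : 0 <= K1 by rewrite /K1; lra.
(* The terms of [D] ensure [delta * kappa <= 2^-1] and that the quadratic error takes at most half
   of the drift [delta * e2]. *)
pose D := 1 + 2 * kappa + 4 * kappa ^+ 2 * Lam / e2.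
have t0 : 0 <= 4 * kappa ^+ 2 * Lam / e2.
  apply: divr_ge0; last exact: ltW.
  by apply: mulr_ge0 => //; apply: mulr_ge0 => //; exact: sqr_ge0.
have D0 : 0 < D by rewrite /D; lra.
pose delta := D^-1.
have d0 : 0 < delta by rewrite invr_gt0.
have dD : delta * D = 1 by rewrite mulVf// gt_eqF.
have dk : delta * kappa <= 2^-1.
  have : 0 <= delta * (4 * kappa ^+ 2 * Lam / e2) by rewrite mulr_ge0// ltW.
  by move: dD; rewrite /D => h1 h2; nra.
have dq : 2 * (delta * kappa) ^+ 2 * Lam <= delta * (e2 / 2).
  have : delta * (4 * kappa ^+ 2 * Lam / e2) <= 1.
    have : 0 <= delta * kappa by rewrite mulr_ge0// ltW.
    by move: dD; rewrite /D => h1 h2; nra.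
  rewrite mulrA ler_pdivrMr// mul1r => h.
  have := ler_wpM2l (ltW d0) h; nra.
(* Once the spread is at least [L0], the term [K1 / (2 * spread x)] is at most [e2 / 4]; below [L0]
   the exponential is bounded and goes into the additive constant. *)
pose L0 := 2 * K1 / e2.
exists delta, (delta * e2 / 4), (expR (delta * L0) * (delta * K1 / 2)), c,
  (1 + M).
split.
- split => //; [by rewrite divr_gt0// mulr_gt0| |exact: ltW].
  by rewrite mulr_ge0 ?expR_ge0// divr_ge0// mulr_ge0// ltW.
- by move=> x; exact: spread_lower.
- exact: spread_upper.
move=> x; have L1 := spread_ge1 x.
have Lp : 0 < spread x by lra.
apply: (le_trans (exponential_spread_drift delta kappa Lam x (ltW d0) kap0 dk _
  _)).
- by move=> i e' e1; exact: spread_shift_bound.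
- exact: total_rate_le.
have H1 : drift m a b energy x / (2 * spread x) <= - e2 + K1 / (2 * spread x).
  rewrite -[X in X + _](mulfK (_ : 2 * spread x != 0));
    last by rewrite gt_eqF// mulr_gt0.
  rewrite -mulrDl ler_wpM2r ?invr_ge0 ?mulr_ge0 ?(ltW Lp)//.
  apply: (le_trans (energy_drift x)).
  have := prefix_sums_le_span _ e x he v0; rewrite -/(lin _ x) => h.
  have s1 := spread_upper x.
  have s2 : e2 * (spread x - 1) <= e * spanR x.
    rewrite /e2 mulrAC ler_pdivrMr// -mulrA ler_wpM2l ?(ltW e0)//; lra.
  by rewrite /K1; lra.
have H2 := ler_wpM2l (ltW d0) H1.
apply: (@le_trans _ _ (expR (delta * spread x) * (delta * (- e2 / 2 + K1 / (2 *
  spread x))))).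
  by rewrite ler_wpM2l ?expR_ge0//; lra.
rewrite -lerBlDl.
rewrite (_ : _ - _ = expR (delta * spread x) * (delta * (- e2 / 4 + K1 / (2 *
  spread x)))); last by lra.
have [big|small] := leP L0 (spread x).
  apply: (@le_trans _ _ 0); last first.
    by rewrite mulr_ge0 ?expR_ge0// divr_ge0// mulr_ge0// ltW.
  rewrite mulr_ge0_le0 ?expR_ge0// mulr_ge0_le0 ?(ltW d0)//.
  have : K1 / (2 * spread x) <= e2 / 4.
    rewrite ler_pdivrMr ?mulr_gt0//.
    by move: big; rewrite /L0 ler_pdivrMr//; lra.
  lra.
apply: (@le_trans _ _ (expR (delta * spread x) * (delta * K1 / 2))).
  rewrite ler_wpM2l ?expR_ge0// -mulrA ler_wpM2l ?(ltW d0)//.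
  have : K1 / (2 * spread x) <= K1 / 2.
    by rewrite ler_wpM2l// lef_pV2 ?posrE ?mulr_gt0//; lra.
  lra.
rewrite ler_wpM2r//; first by rewrite divr_ge0// mulr_ge0// ltW.
by rewrite ler_expR ler_wpM2l ?(ltW d0)// ltW.
Qed.

End Lyapunov.

(** * The difference of two centres of mass and the drift of its square *)

Section Imbalance.
Context {R : realType} {n : nat} {m a b : 'I_n.+1 -> R}.
Hypotheses (hm : forall i, 0 < m i) (ha : forall i, 0 <= a i)
  (hb : forall i, 0 <= b i).
Implicit Types (x : config n) (i j l : 'I_n.+1) (y : {ffun 'I_n.+1 -> int}).
Variable k : 'I_n.+1.
Hypothesis kn : (k < n)%N.

Let A0 x i : 0 <= rateA m a x i. Proof. exact: rateA_ge0. Qed.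
Let B0 x i : 0 <= rateB m b x i. Proof. exact: rateB_ge0. Qed.

Local Notation M := (Msum m ord_max).

Let M0 : 0 < M. Proof. exact: Msum_gt0. Qed.
Let Mk0 : 0 < Msum m k. Proof. exact: Msum_gt0. Qed.

Let MkM : Msum m k < M.
Proof.
rewrite Msum_max /Msum [ltRHS](bigID (fun i : 'I_n.+1 => (i <= k)%N)) /=.
rewrite ltrDl (bigD1 ord_max)/=; last by rewrite -ltnNge.
by apply: ltr_pwDl => //; apply: sumr_ge0 => i _; exact: ltW.
Qed.

(** Weights of the centre of mass of all particles minus that of the particles up to [k]. *)
Definition imbalance i : R := m i / M - (i <= k)%N%:R * (m i / Msum m k).

Lemma imbalance_prefix l : \sum_(i < n.+1 | (i <= l)%N) imbalance i =
  Msum m l / M - if (l <= k)%N then Msum m l / Msum m k else 1.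
Proof.
rewrite /imbalance sumrB -mulr_suml; congr (_ - _).
have [lk|lk] := leqP l k.
  rewrite /Msum mulr_suml; apply: eq_bigr => i il.
  by rewrite (leq_trans il lk) mul1r.
rewrite (bigID (fun i : 'I_n.+1 => (i <= k)%N)) /= [X in _ + X]big1; last first.
  by move=> i /andP[_ /negbTE ->]; rewrite mul0r.
rewrite addr0 (eq_bigl (fun i : 'I_n.+1 => (i <= k)%N)); last first.
  by move=> i; case: (boolP (i <= k)%N) => [ik|];
    rewrite ?andbF// (leq_trans ik (ltnW lk)).
under eq_bigr => i ik do rewrite ik mul1r.
by rewrite -mulr_suml divff// gt_eqF.
Qed.

Lemma imbalance_total : \sum_i imbalance i = 0.
Proof.
rewrite (eq_bigl (fun j : 'I_n.+1 => (j <= @ord_max n)%N)); last first.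
  by move=> j; rewrite -ltnS ltn_ord.
by rewrite imbalance_prefix /= leqNgt kn /= divff ?subrr// gt_eqF.
Qed.

Lemma imbalance_prefix_bounds l :
  -1 <= \sum_(i < n.+1 | (i <= l)%N) imbalance i <= 0.
Proof.
have h1 : 0 <= Msum m l / M <= 1.
  by rewrite divr_ge0 ?(ltW (Msum_gt0 hm _))//= ler_pdivrMr// mul1r Msum_le//
    -ltnS.
rewrite imbalance_prefix; case: (boolP (l <= k)%N) => lk; last by lra.
have h2 : Msum m l / Msum m k <= 1 by rewrite ler_pdivrMr// mul1r Msum_le.
have h3 : Msum m l / M <= Msum m l / Msum m k.
  by rewrite ler_wpM2l ?(ltW (Msum_gt0 hm _))// lef_pV2 ?posrE// ltW.
by lra.
Qed.

Lemma imbalance_ge0 x : 0 <= lin imbalance x.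
Proof.
have := prefix_sums_le_span (fun i => - imbalance i) 0 x.
rewrite oppr0 mul0r !sumrN imbalance_total oppr0 => /(_ _ erefl) h.
rewrite -oppr_le0 /lin -sumrN; under eq_bigr do rewrite -mulNr.
apply: h => l _; rewrite sumrN oppr_ge0.
by case/andP: (imbalance_prefix_bounds l).
Qed.

Lemma imbalance_le_span x : lin imbalance x <= spanR x.
Proof.
apply: lin_le_span; last exact: imbalance_total.
by move=> l _; case/andP: (imbalance_prefix_bounds l).
Qed.

(** The particles up to [k] have strictly less than the total mass. Hence every jump moves the
    imbalance, which keeps the drift of its square away from zero. *)
Lemma imbalance_neq0 i : imbalance i != 0.
Proof.
have mi := hm i; rewrite /imbalance; case: (i <= k)%N => /=; last first.
  by rewrite mul0r subr0 mulf_neq0 ?invr_eq0 ?gt_eqF.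
rewrite mul1r -mulrBr; apply: mulf_neq0; first by rewrite gt_eqF.
by rewrite subr_eq0 (inj_eq invr_inj) gt_eqF.
Qed.

(* The linear term is nonnegative: the first k particles can only be pushed
   back by the others. *)
Lemma imbalance_sqr_drift :
  Usum m a b ord_max / M <= Usum m a b k / Msum m k -> 0 < activity m a b ->
  exists2 c : R, 0 < c & forall x, c <= drift m a b (fun y =>
    lin imbalance y ^+ 2) x.
Proof.
move=> hU act0.
have [i _|c [c0 _ /(_ _ isT) cP]] := @finite_positive_lower_bound R 'I_n.+1
  xpredT
    (fun i => imbalance i ^+ 2 / m i).
  by rewrite divr_gt0// lt_def sqr_ge0 sqrf_eq0 imbalance_neq0.
exists (c * activity m a b); first by rewrite mulr_gt0.
move=> x; rewrite driftE.
rewrite (eq_bigr (fun i => 2 * lin imbalance x * (imbalance i * (rateB m b x i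
  - rateA m a x i))
  + imbalance i ^+ 2 * (rateA m a x i + rateB m b x i))); last first.
  by move=> i _; rewrite !lin_shift mulrN1z; ring.
rewrite big_split/= -mulr_sumr -[leLHS]add0r; apply: lerD.
  rewrite mulr_ge0 ?mulr_ge0 ?imbalance_ge0//.
  rewrite /imbalance; under eq_bigr do rewrite mulrBl.
  rewrite sumrB subr_ge0.
  have -> : \sum_i m i / M * (rateB m b x i - rateA m a x i) = - (Usum m a b
    ord_max / M).
    rewrite -mulNr -(mass_flux (m := m) (a := a) (b := b) hm x) mulr_suml.
    by apply: eq_bigr => i _; rewrite mulrAC.
  have -> : \sum_(i < n.+1) (i <= k)%N%:R * (m i / Msum m k) * (rateB m b x i -
    rateA m a x i) =
     (\sum_(i < n.+1 | (i <= k)%N) m i * (rateB m b x i - rateA m a x i)) /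
       Msum m k.
    rewrite mulr_suml [RHS]big_mkcond; apply: eq_bigr => i _.
    by case: (i <= k)%N => /=; rewrite ?mul1r ?mul0r// mulrAC.
  apply: (@le_trans _ _ (- Usum m a b k / Msum m k)).
    by rewrite ler_wpM2r ?invr_ge0 ?(ltW Mk0)// prefix_flux.
  by rewrite mulNr lerN2.
(* The quadratic part is at least [c] times the mass-weighted jump rate, that is [activity]. *)
rewrite -(mass_rates hm x) mulr_sumr; apply: ler_sum => i _; rewrite mulrA.
apply: ler_wpM2r; first by rewrite addr_ge0.
by have := cP i; rewrite ler_pdivlMr.
Qed.

(** Controls the second-order term of [mean_lower] for the unbounded squared imbalance. *)
Lemma imbalance_sqr_growth : exists2 C : R, 0 <= C & forall x,
  \sum_e elastic_rate m a b x e * lin imbalance (elastic_target x e) ^+ 2 <=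
  C * (1 + lin imbalance x ^+ 2).
Proof.
have [c [c0 _ /(_ _ isT) cm]] := @finite_positive_lower_bound R 'I_n.+1 xpredT
  m (fun i _ => hm i).
pose W := \sum_i imbalance i ^+ 2.
have W0 : 0 <= W by apply: sumr_ge0 => i _; exact: sqr_ge0.
have Wi i : imbalance i ^+ 2 <= W.
  by rewrite /W (bigD1 i)//= lerDl sumr_ge0// => j _; exact: sqr_ge0.
have act0 : 0 <= activity m a b by exact: activity_ge0.
exists (activity m a b / c * (2 + 2 * W)).
  by rewrite mulr_ge0 ?divr_ge0 ?(ltW c0)// addr_ge0// mulr_ge0.
move=> x; set D := lin imbalance x.
have step i (e : bool) : elastic_rate m a b x (i, e) *
    lin imbalance (elastic_target x (i, e)) ^+ 2 <=
    elastic_rate m a b x (i, e) * ((2 + 2 * W) * (1 + D ^+ 2)).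
  have [->|/elastic_targetE ->] := eqVneq (elastic_rate m a b x (i, e)) 0.
    by rewrite !mul0r.
  rewrite ler_wpM2l ?elastic_rate_ge0// lin_shift -/D.
  set s : R := (if e then 1 else -1)%:~R.
  have s2 : s ^+ 2 = 1 by rewrite /s; case: (e); rewrite ?mulrN1z ?sqrrN expr1n.
  have h1 : (D + imbalance i * s) ^+ 2 <= 2 * D ^+ 2 + 2 * imbalance i ^+ 2.
    have := sqr_ge0 (D - imbalance i * s).
    have : (imbalance i * s) ^+ 2 = imbalance i ^+ 2 by rewrite exprMn s2 mulr1.
    by lra.
  have := Wi i; have := sqr_ge0 D;
    have : 0 <= W * D ^+ 2 by rewrite mulr_ge0 ?sqr_ge0.
  by lra.
rewrite sum_jumps.
apply: (@le_trans _ _ (\sum_i (rateA m a x i + rateB m b x i) * ((2 + 2 * W) *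
  (1 + D ^+ 2)))).
  apply: ler_sum => i _; apply: (le_trans (lerD (step i true) (step i false))).
  by rewrite -mulrDl addrC.
rewrite -mulr_suml mulrA; apply: ler_wpM2r; first by rewrite addr_ge0 ?sqr_ge0.
apply: ler_wpM2r; first by rewrite addr_ge0 ?mulr_ge0.
exact: total_rate_le.
Qed.

End Imbalance.

(** * Stable clouds *)

Lemma geometric_sum_le {R : realFieldType} (q : R) (n : nat) :
  0 <= q < 1 -> \sum_(i < n) q ^+ i <= (1 - q)^-1.
Proof.
move=> /andP[q0 q1]; have h : 0 < 1 - q by rewrite subr_gt0.
rewrite -[leRHS]mul1r ler_pdivlMr//.
have := subrX1 q n; set S := \sum_(_ < _) _ => E.
have := exprn_ge0 n q0.
have -> : S * (1 - q) = 1 - q ^+ n by move: E; lra.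
lra.
Qed.

Lemma telescoping_inverse_sum_le {R : realFieldType} (n : nat) :
  \sum_(k < n) (k.+1%:R * k.+2%:R : R)^-1 <= 1.
Proof.
have -> : \sum_(k < n) (k.+1%:R * k.+2%:R : R)^-1 = 1 - n.+1%:R^-1.
  elim: n => [|n IH]; first by rewrite big_ord0 invr1 subrr.
  rewrite big_ord_recr /= IH.
  have n0 := ler0n R n; rewrite -[n.+2%:R]natr1 -[n.+1%:R]natr1.
  by field; do ?[apply/andP; split]; rewrite gt_eqF//; lra.
by rewrite gerBl invr_ge0.
Qed.

(** * Tail and growth of the span, and exponential bounds for the momentum *)

Section StableCloud.
Context {R : realType} {n : nat} {m a b : 'I_n.+1 -> R}.
Hypotheses (hm : forall i, 0 < m i) (ha : forall i, 0 <= a i)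
  (hb : forall i, 0 <= b i).
Context {d : measure_display} {Omega : measurableType d}
  {P : probability Omega R} {x0 : config n} {X : R -> Omega -> config n}.
Hypothesis el : elastic_system m a b P x0 X.

Lemma elastic_transition : exists p, [/\ transition_function p,
  has_rates p (Qmatrix m a b),
  forall l : seq (R * config n), path <=%R 0 (map fst l) ->
      P [set w | forall ty : R * config n, ty \in l -> X ty.1 w = ty.2] =
      (path_prob p 0 x0 l)%:E &
  forall F c x t, (forall y, 0 <= F y) -> 0 <= t ->
    (forall x, drift m a b F x <= c * F x) ->
    (mean p t x F <= (expR (c * t) * F x)%:E)%E].
Proof.
have [p [tf pq fdd]] := mc_fdd el.
have [mu [mu0 _ /(_ _ isT) hmu]] := @finite_positive_lower_bound R 'I_n.+1
  xpredT m (fun i _ => hm i).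
have jg := elastic_jump_generator hm ha hb mu mu0 hmu.
exists p; split => // F c x t F0 t0 HF.
exact: (mean_le_expR tf pq jg).
Qed.

Let mX : forall (t : R) y, 0 <= t -> measurable [set w | X t w = y].
Proof. exact: mc_measurable el. Qed.

Let rcX : forall w (t : R), 0 <= t -> \forall s \near t^'+, X s w = X t w.
Proof. exact: mc_right_continuous el. Qed.

Section Confined.
Context {delta g K c C : R}.
Hypotheses (d0 : 0 < delta) (g0 : 0 < g) (K0 : 0 <= K) (c0 : 0 < c) (C0 : 0 <=
  C)
  (lo : forall x : config n, c * spanR x <= spread (m := m) x)
  (up : forall x : config n, spread (m := m) x <= 1 + C * spanR x)
  (dr : forall x : config n, drift m a b (fun y =>
    expR (delta * spread (m := m) y)) x <=
      - g * expR (delta * spread (m := m) x) + K).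

Let f (y : {ffun 'I_n.+1 -> int}) := expR (delta * spread (m := m) y).

Let f0 y : 0 <= f y. Proof. exact: expR_ge0. Qed.

(** As [f] is at least one, it absorbs the constant [K]; this gives the growth bound that the
    maximal inequality requires. *)
Lemma spread_drift_le x : drift m a b f x <= K * f x.
Proof.
apply: (le_trans (dr x)).
have f1 : 1 <= f x.
  rewrite -expR0 ler_expR mulr_ge0 ?(ltW d0)//.
  by apply: le_trans (spread_ge1 hm _).
have := f0 x; have : 0 <= g * f x by rewrite mulr_ge0 ?(ltW g0).
by have := ler_wpM2l K0 f1; rewrite mulr1 mulNr -/(f x); lra.
Qed.

Lemma spread_mean p t : transition_function p -> has_rates p (Qmatrix m a b) ->
  0 <= t -> (mean p t x0 f <= (f x0 + K / g)%:E)%E.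
Proof.
move=> tf pq t0.
have [mu [mu0 _ /(_ _ isT) hmu]] := @finite_positive_lower_bound R 'I_n.+1
  xpredT m (fun i _ => hm i).
have jg := elastic_jump_generator hm ha hb mu mu0 hmu.
exact: (mean_le_lyapunov tf pq jg).
Qed.

(** Markov's inequality for the Lyapunov function, obtained from the maximal inequality with the
    single time [t]. *)
Lemma confined_tail_bound :
  span_tail_bound P x0 X (expR delta + K / g + delta * C) (delta * c).
Proof.
move=> s s0; apply: ge_ereal_sup => _ [t /= t0 <-].
have [p [tf pq fdd fm]] := elastic_transition.
pose A := expR (delta * c * s).
have A0 : 0 < A by exact: expR_gt0.
have := @maximal_inequality_seq R (config n) d Omega P x0 X p tf mX fdd f K A
  f0 K0 A0
  (fun u x u0 => fm f K x u f0 u0 spread_drift_le) t t [:: t] t0.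
rewrite /= lexx => /(_ isT isT) H.
apply: (@le_trans _ _ ((expR (K * (t - t)) / A)%:E * mean p t x0 f)%E).
  apply: le_trans H; rewrite le_measure ?inE//.
  - exact: (measurable_state mX [set x : config n | s <= (config_span x)%:~R]).
  - rewrite (_ : mkset _ = [set w | A <= f (X t w)]).
      exact: (measurable_state mX [set x : config n | A <= f x]).
    by apply/seteqP; split => w /=; [move=> [u];
      rewrite inE => /eqP ->|move=> h; exists t; rewrite ?inE].
  - move=> w /= sw; exists t; first by rewrite inE.
    rewrite /A /f ler_expR -mulrA ler_wpM2l ?(ltW d0)//.
    by apply: le_trans (lo _); rewrite ler_wpM2l ?(ltW c0).
apply: (@le_trans _ _ ((expR (K * (t - t)) / A)%:E * (f x0 + K / g)%:E)%E).
  by apply: lee_wpmul2l; [rewrite lee_fin divr_ge0 ?expR_ge0|exact: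
    spread_mean].
rewrite -EFinM lee_fin subrr mulr0 expR0 mul1r mulrC expRN -/A.
rewrite ler_wpM2r ?invr_ge0 ?(ltW A0)//.
(* The summands of [Z] dominate in turn the prefactor [expR delta], the constant [K / g] and the
   exponent [delta * C]. *)
set Z := _ + delta * C; rewrite -/(spanR x0).
have Kg : 0 <= K / g by rewrite divr_ge0 ?(ltW g0).
have dC : 0 <= delta * C by rewrite mulr_ge0 ?(ltW d0).
have e0 := expR_gt0 delta; have S0 := spanR_ge0 (R := R) x0.
have h1 : f x0 <= expR delta * expR (Z * spanR x0).
  rewrite -expRD ler_expR.
  have h := ler_wpM2l (ltW d0) (up x0); apply: (le_trans h).
  rewrite mulrDr mulr1 lerD2l mulrA ler_wpM2r// /Z; lra.
have h2 : expR delta * expR (Z * spanR x0) <= Z * expR (Z * spanR x0).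
  by rewrite ler_wpM2r ?expR_ge0// /Z; lra.
have h3 : K / g <= Z by rewrite /Z; lra.
by rewrite mulrDr mulr1 [leRHS]addrC lerD// (le_trans h1 h2).
Qed.

Lemma confined_eventually (lvl : R^nat) (B : R) : (forall k, 0 < lvl k) ->
  (forall k : nat, \sum_(i < k) (lvl i)^-1 <= B) ->
  {ae P, forall w, exists k0 : nat, forall t, k0%:R <= t -> 0 <= t ->
     delta * c * spanR (X t w) < ln (lvl (Num.truncn t))}.
Proof.
move=> l0 sB; have [p [tf pq fdd fm]] := elastic_transition.
have Kg : 0 <= f x0 + K / g by rewrite addr_ge0 ?f0// divr_ge0 ?(ltW g0).
have := @eventually_below R (config n) d Omega P x0 X p tf mX fdd rcX f K lvl
  (fun=> f x0 + K / g) ((f x0 + K / g) * B) f0 K0 l0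
  (fun u x u0 => fm f K x u f0 u0 spread_drift_le).
move=> /(_ (fun k => spread_mean p k%:R tf pq (ler0n _ _))) H.
apply: filterS (H _).
  move=> w [k0 H0]; exists k0 => t t1 t2; have := H0 t t1 t2.
  rewrite -[X in _ < X]lnK ?posrE// ltr_expR; apply: le_lt_trans.
  by rewrite -mulrA ler_wpM2l ?(ltW d0).
by move=> k; rewrite -mulr_sumr ler_wpM2l.
Qed.

(** The levels [(k + 1) (k + 2)] have summable inverses and are at most [t ^+ 4] for [t > 2], so the
    span is eventually at most [4 / (delta * c)] times [ln t]. *)
Lemma confined_log_growth : span_log_growth P X.
Proof.
have := @confined_eventually (fun k => k.+1%:R * k.+2%:R) 1.
move=> /(_ _ (@telescoping_inverse_sum_le R)) H; apply: filterS (H _);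
  last first.
  by move=> k; rewrite mulr_gt0.
move=> w [k0 H0]; have dc : 0 < delta * c by rewrite mulr_gt0.
apply: (@le_lt_trans _ _ (4 / (delta * c))%:E); last exact: ltry.
pose V := [set t : R | k0%:R + 2 < t].
apply: (@le_trans _ _ (ereal_sup ((fun t =>
  ((config_span (X t w))%:~R / ln t)%:E) @` V))).
  apply: ereal_inf_lbound; exists V => //.
  by exists (k0%:R + 2); split => //; exact: num_real.
apply: ge_ereal_sup => _ [t tV <-]; rewrite lee_fin -/(spanR _).
have k00 : (0 : R) <= k0%:R by [].
have t2 : 2 < t by move: tV; rewrite /V /=; lra.
have lnt : 0 < ln t by rewrite ln_gt0//; lra.
rewrite ler_pdivrMr// mulrAC ler_pdivlMr// mulrC.
have tk : k0%:R <= t by move: tV; rewrite /V /=; lra.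
have t0 : 0 <= t by lra.
apply: (le_trans (ltW (H0 t tk t0))).
have tr : (Num.truncn t)%:R <= t by rewrite truncn_le.
set k := Num.truncn t in tr *.
have kk : k.+1%:R * k.+2%:R <= t ^+ 4.
  rewrite -[k.+2%:R]natr1 -[k.+1%:R]natr1.
  have s1 : k%:R + 1 <= t * t.
    have : 0 <= (t - 2) * t by rewrite mulr_ge0; lra.
    by lra.
  have s2 : k%:R + 1 + 1 <= t * t.
    have : 0 <= (t - 2) * t by rewrite mulr_ge0; lra.
    by lra.
  rewrite (_ : t ^+ 4 = (t * t) * (t * t)); last by ring.
  by apply: ler_pM => //; rewrite addr_ge0.
have tp : 0 < t by lra.
rewrite (_ : 4 * ln t = ln (t ^+ 4)); last by rewrite lnXn// mulr_natl.
by rewrite ler_ln ?posrE ?mulr_gt0 ?exprn_gt0.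
Qed.

Lemma confined_sublinear :
  {ae P, forall w, forall j : nat, exists k0 : nat, forall t,
    k0%:R <= t -> 0 <= t ->
     spanR (X t w) <= t / j.+1%:R}.
Proof.
apply: ae_foralln => j.
have dc : 0 < delta * c by rewrite mulr_gt0.
(* Levels [expR (e * k)] have a geometric series of inverses, and their logarithm is at most
   [e * t]. *)
pose e : R := delta * c / j.+1%:R.
have e0 : 0 < e by rewrite divr_gt0.
have := @confined_eventually (fun k => expR (e * k%:R)) (1 - expR (- e))^-1.
move=> /(_ (fun k => expR_gt0 _)) H; apply: filterS (H _).
  move=> w [k0 H0]; exists k0 => t t1 t2.
  have := H0 t t1 t2; rewrite expRK => /ltW h.
  rewrite -(ler_pM2l dc); apply: (le_trans h).
  rewrite /e mulrA [leRHS]mulrAC.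
  by rewrite ler_wpM2l ?(ltW e0)// truncn_le.
move=> k; rewrite (eq_bigr (fun i : 'I_k => expR (- e) ^+ i)).
  by apply: geometric_sum_le; rewrite expR_ge0/= expR_lt1// oppr_lt0.
by move=> i _; rewrite -expRN -expRM_natr mulNr.
Qed.

End Confined.

(** An exponential Chernoff bound: the levels grow faster than the means by the rate [theta ^+ 2],
    so the ratios form a geometric series. *)
Lemma mass_eventually_below (theta : R) : `|theta| * Msum m ord_max <= 2^-1 ->
  theta != 0 ->
  {ae P, forall w, exists k0 : nat, forall t, k0%:R <= t -> 0 <= t ->
     theta * lin m (X t w) < (theta * - Usum m a b ord_max +
       theta ^+ 2 * (2 * (Msum m ord_max * activity m a b) + 1)) * (Num.truncn
         t)%:R}.
Proof.
move=> tM tn0; have [p [tf pq fdd fm]] := elastic_transition.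
pose Q := 2 * (Msum m ord_max * activity m a b).
pose c := theta * - Usum m a b ord_max + theta ^+ 2 * Q.
pose f (y : {ffun 'I_n.+1 -> int}) := expR (theta * lin m y).
have f0 y : 0 <= f y by exact: expR_ge0.
have fd x : drift m a b f x <= c * f x.
  apply: (le_trans (exponential_drift hm ha hb theta x tM)).
  by rewrite ler_wpM2r ?expR_ge0// /c /Q; lra.
(* The maximal inequality asks for a nonnegative growth rate, whereas [c] may be negative. *)
have fd' x : drift m a b f x <= `|c| * f x.
  by apply: (le_trans (fd x)); rewrite ler_wpM2r// ler_norm.
have tt0 : 0 < theta ^+ 2 by rewrite lt_def sqr_ge0 sqrf_eq0 tn0.
pose e := theta ^+ 2.
have := @eventually_below R (config n) d Omega P x0 X p tf mX fdd rcX f `|c|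
  (fun k => expR ((c + e) * k%:R)) (fun k => expR (c * k%:R) * f x0)
  (f x0 * (1 - expR (- e))^-1) f0 (normr_ge0 _) (fun k => expR_gt0 _)
  (fun u x u0 => fm f `|c| x u f0 u0 fd') (fun k =>
    fm f c x0 k%:R f0 (ler0n _ _) fd).
move=> H; apply: filterS (H _).
  move=> w [k0 H0]; exists k0 => t t1 t2; have := H0 t t1 t2.
  by rewrite ltr_expR /c /e; rewrite (_ : _ + theta ^+ 2 = theta * - Usum m a b
    ord_max +
       theta ^+ 2 * (Q + 1)) //; ring.
move=> k; rewrite (eq_bigr (fun i : 'I_k => f x0 * expR (- e) ^+ i)).
  rewrite -mulr_sumr ler_wpM2l//.
  by apply: geometric_sum_le; rewrite expR_ge0/= expR_lt1// oppr_lt0.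
move=> i _; rewrite -expRN -expRM_natr mulrAC -expRD mulrC; congr (_ * expR _).
by ring.
Qed.

End StableCloud.

(** * The limiting speed *)

Section Speed.
Context {R : realType} {n : nat} {m a b : 'I_n.+1 -> R}.
Hypotheses (hm : forall i, 0 < m i) (ha : forall i, 0 <= a i)
  (hb : forall i, 0 <= b i).
Context {d : measure_display} {Omega : measurableType d}
  {P : probability Omega R} {x0 : config n} {X : R -> Omega -> config n}.
Hypothesis el : elastic_system m a b P x0 X.

Local Notation M := (Msum m ord_max).
Local Notation U := (Usum m a b ord_max).

Lemma mass_speed : {ae P, forall w, forall j : nat, exists k0 : nat, forall t,
  k0%:R <= t -> 0 <= t -> `|lin m (X t w) + U * t| <= t / j.+1%:R}.
Proof.
apply: ae_foralln => j.
have M0 : 0 < M by exact: Msum_gt0.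
pose Q : R := 2 * (M * activity m a b) + 1.
have Q0 : 0 < Q by rewrite ltr_wpDl// !mulr_ge0 ?(ltW M0) ?activity_ge0.
(* The two terms give [th * M <= 2^-1], needed for the exponential bound, and make the error rate
   [th * Q] at most half of [j.+1%:R^-1]. *)
pose D : R := 2 * M + 2 * Q * j.+1%:R.
have QD0 : 0 < 2 * Q * j.+1%:R by rewrite !mulr_gt0.
have D0 : 0 < D by rewrite /D; lra.
pose th := D^-1.
have th0 : 0 < th by rewrite invr_gt0.
have thD : th * D = 1 by rewrite mulVf// gt_eqF.
have thM : th * M <= 2^-1.
  have : 0 <= th * (2 * Q * j.+1%:R) by rewrite mulr_ge0// ltW.
  by move: thD; rewrite /D; lra.
have thQ : th * Q * j.+1%:R <= 2^-1.
  have : 0 <= th * M by rewrite mulr_ge0// ltW.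
  by move: thD; rewrite /D; lra.
have key (s : R) : `|s| = 1 -> {ae P, forall w, exists k0 : nat, forall t,
    k0%:R <= t -> 0 <= t -> s * (lin m (X t w) + U * t) <= t / j.+1%:R}.
  move=> s1; have sn0 : s != 0 by rewrite -normr_eq0 s1 oner_neq0.
  have := @mass_eventually_below R n m a b hm ha hb d Omega P x0 X el (s * th).
  rewrite normrM s1 mul1r (gtr0_norm th0) mulf_neq0 ?(gt_eqF th0)// =>
    /(_ thM isT).
  apply: filterS => w [k0 H0].
  (* The second threshold lets the other half absorb the cost, at most the absolute value of [U], of
     replacing [t] by its integer part. *)
  exists (maxn k0 (Num.truncn (2 * j.+1%:R * `|U|)).+1) => t t1 t2.
  have tk : k0%:R <= t by apply: le_trans t1; rewrite ler_nat leq_maxl.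
  have tU : 2 * j.+1%:R * `|U| <= t.
    apply: le_trans t1; apply: le_trans (ltW (truncnS_gt _)) _.
    by rewrite ler_nat leq_maxr.
  have := H0 t tk t2; rewrite -/Q => h.
  have ss : s ^+ 2 = 1 by rewrite -[LHS]real_normK ?num_real// s1 expr1n.
  have {}h : s * lin m (X t w) < (- s * U + th * Q) * (Num.truncn t)%:R.
    rewrite -(ltr_pM2l th0).
    rewrite (_ : th * (s * _) = s * th * lin m (X t w)); last by ring.
    apply: (lt_le_trans h); rewrite exprMn ss mul1r.
    by rewrite le_eqVlt; apply/orP; left; apply/eqP; ring.
  set k : R := (Num.truncn t)%:R in h.
  have k1 : k <= t by rewrite truncn_le.
  have k2 : t < k + 1 by rewrite natr1 truncnS_gt.
  have h1 : - s * U * k <= - s * U * t + `|U|.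
    have : `|s * U * (t - k)| <= `|U|.
      rewrite !normrM s1 mul1r ler_piMr//.
      by rewrite ger0_norm ?subr_ge0//; lra.
    by rewrite ler_norml => /andP[_]; lra.
  have h2 : th * Q * k <= th * Q * t by rewrite ler_wpM2l// mulr_ge0// ltW.
  have j0 : (0 : R) < j.+1%:R by [].
  rewrite ler_pdivlMr//.
  have h3 : s * (lin m (X t w) + U * t) <= `|U| + th * Q * t by lra.
  apply: (le_trans (ler_wpM2r (ltW j0) h3)).
  have := ler_wpM2r t2 thQ; lra.
have kp := key 1 (normr1 _); have kn := key (-1) (normrN1 _).
apply: filterS2 kp kn => w [k1 H1] [k2 H2]; exists (maxn k1 k2) => t t1 t2.
have t11 : k1%:R <= t by apply: le_trans t1; rewrite ler_nat leq_maxl.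
have t12 : k2%:R <= t by apply: le_trans t1; rewrite ler_nat leq_maxr.
rewrite ler_norml; have := H1 t t11 t2; have := H2 t t12 t2.
by rewrite mulN1r mul1r lerNl => -> ->.
Qed.

(** Every particle is within one span of the centre of mass, hence shares its speed once the span is
    sublinear. *)
Lemma sublinear_limiting_speed :
  {ae P, forall w, forall j : nat, exists k0 : nat, forall t,
    k0%:R <= t -> 0 <= t ->
     spanR (X t w) <= t / j.+1%:R} ->
  forall i, limiting_speed P X (- (U / M)) i.
Proof.
move=> sub i; apply: filterS2 sub mass_speed => w H1 H2.
have M0 : 0 < M by exact: Msum_gt0.
apply/cvgrPdist_le => /= e e0.
pose c : R := 1 + M^-1.
have c0 : 0 < c by rewrite addr_gt0// invr_gt0.
pose j := Num.truncn (c / e).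
have cj : c / j.+1%:R <= e.
  by rewrite ler_pdivrMr// mulrC -ler_pdivrMr// ltW// truncnS_gt.
have [k1 {}H1] := H1 j; have [k2 {}H2] := H2 j.
exists (k1%:R + k2%:R); split; first exact: num_real.
move=> t /= kt.
have k10 : (0 : R) <= k1%:R by []. have k20 : (0 : R) <= k2%:R by [].
have t0 : 0 < t by lra.
have h1 := H1 t; have h2 := H2 t.
have {}h1 : spanR (X t w) <= t / j.+1%:R by apply: h1; lra.
have {}h2 : `|lin m (X t w) + U * t| <= t / j.+1%:R by apply: h2; lra.
have h3 := deviation_le_span (R := R) hm (X t w) i.
rewrite (_ : _ - _ = - (((X t w i)%:~R - lin m (X t w) / M) + (lin m (X t w) +
  U * t) / M) / t); last first.
  by field; rewrite !gt_eqF.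
rewrite normrM normrN (gtr0_norm (_ : 0 < t^-1)) ?invr_gt0// ler_pdivrMr//.
apply: (le_trans (ler_normD _ _)).
rewrite [X in _ + X]normrM (gtr0_norm (_ : 0 < M^-1)) ?invr_gt0//.
have h4 : `|lin m (X t w) + U * t| / M <= t / j.+1%:R / M.
  by rewrite ler_wpM2r// invr_ge0 ltW.
have := ler_wpM2r (ltW t0) cj; rewrite /c.
rewrite (_ : _ * t = t / j.+1%:R + t / j.+1%:R / M); last by ring.
apply: le_trans; apply: lerD => //; exact: le_trans h3 h1.
Qed.

End Speed.

(** * Necessity of the cloud condition *)

Section Necessity.
Context {R : realType} {n : nat} {m a b : 'I_n.+1 -> R}.
Hypotheses (hm : forall i, 0 < m i) (ha : forall i, 0 <= a i)
  (hb : forall i, 0 <= b i).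
Context {d : measure_display} {Omega : measurableType d}
  {P : probability Omega R} {x0 : config n} {X : R -> Omega -> config n}.
Hypothesis el : elastic_system m a b P x0 X.

Let mX : forall (t : R) y, 0 <= t -> measurable [set w | X t w = y].
Proof. exact: mc_measurable el. Qed.

Section FixedTransition.
Context {p : R -> config n -> config n -> R}.
Hypotheses (tf : transition_function p)
  (fdd : forall l : seq (R * config n), path <=%R 0 (map fst l) ->
      P [set w | forall ty : R * config n, ty \in l -> X ty.1 w = ty.2] =
      (path_prob p 0 x0 l)%:E).

Lemma transition_sum_le_prob (S : seq (config n)) (A : pred (config n)) (t : R)
  :
  uniq S -> 0 <= t ->
  ((\sum_(y <- S | A y) p t x0 y)%:E <= P [set w | A (X t w)])%E.
Proof.
move=> uS t0.
have mA := measurable_state mX [set y | A y] t t0.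
rewrite (total_probability mX _ t mA t0) -sumEFin big_mkcond.
apply: le_trans (sum_seq_le_esum _ S uS _); last by [].
apply: lee_sum => y _; case: ifPn => // Ay.
have := fdd [:: (t, y)]; rewrite /= t0 subr0 mulr1 => /(_ isT) <-.
rewrite le_measure ?inE//.
- rewrite (_ : mkset _ = [set w | X t w = y]); first exact: mX.
  apply/seteqP; split => w /=; first by move=> H; apply: (H (t, y));
    rewrite mem_head.
  by move=> Xy ty; rewrite inE => /eqP ->.
- by apply: measurableI => //; exact: mX.
- move=> w /= H; have Xy : X t w = y by apply: (H (t, y)); rewrite mem_head.
  by split => //=; rewrite Xy.
Qed.

(** The span takes integer values, so the moment is a sum over [j] of [j ^+ 2] times a tail
    probability. *)
Lemma span_second_moment (C0 delta : R) : 0 <= C0 -> 0 < delta ->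
  (forall t s : R, 0 <= t -> 0 <= s ->
    (P [set w | (s <= (config_span (X t w))%:~R)%R] <= (C0 * expR (- (delta *
      s)))%:E)%E) ->
  exists B : R, 0 <= B /\ forall t, 0 <= t ->
    (mean p t x0 (fun x => spanR x ^+ 2)%R <= B%:E)%E.
Proof.
move=> C00 d0 tail.
pose q := expR (- (delta / 2)).
have q01 : 0 <= q < 1.
  by rewrite expR_ge0/= expR_lt1// oppr_lt0 divr_gt0.
(* Half of the exponential decay pays for the square: with [y = delta * j / 2],
   [y ^+ 2 * expR (- y)] is at most 4, whence the factor 16. *)
have term (j : nat) : j%:R ^+ 2 * expR (- (delta * j%:R)) <= 16 / delta ^+ 2 *
  q ^+ j.
  have -> : q ^+ j = expR (- (delta / 2 * j%:R)).
    by rewrite /q -expRM_natr mulNr.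
  set y := delta / 2 * j%:R.
  have y0 : 0 <= y by rewrite mulr_ge0 ?divr_ge0 ?(ltW d0).
  rewrite (_ : delta * j%:R = y + y); last by rewrite /y; field.
  rewrite opprD expRD mulrA ler_wpM2r ?expR_ge0//.
  have e1 : (1 + y / 2) ^+ 2 <= expR y.
    rewrite (_ : expR y = expR (y / 2) ^+ 2); last first.
      by rewrite -expRM_natr; congr expR; field.
    rewrite lerXn2r ?nnegrE ?expR_ge0 ?expR_ge1Dx//.
    by rewrite addr_ge0// divr_ge0.
  have e2 : y ^+ 2 * expR (- y) <= 4.
    rewrite expRN ler_pdivrMr ?expR_gt0//.
    have := sqr_ge0 y; have := e1; lra.
  rewrite ler_pdivlMr ?exprn_gt0//.
  rewrite (_ : _ * _ * _ = 4 * (y ^+ 2 * expR (- y))); last by rewrite /y;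
    field.
  lra.
pose B := C0 * (16 / delta ^+ 2 * (1 - q)^-1).
exists B; split.
  have /andP[_ q1] := q01.
  by rewrite /B !mulr_ge0 ?invr_ge0 ?sqr_ge0// subr_ge0 ltW.
move=> t t0; apply: esum_le_of_seq => S uS; rewrite sumEFin lee_fin.
pose N (y : config n) : nat := `|config_span y|%N.
have NE y : spanR y = (N y)%:R :> R.
  have := spanR_ge0 (R := R) y; rewrite /spanR /N ler0z => h.
  by rewrite -[in LHS](gez0_abs h).
pose J := (\max_(y <- S) N y).+1.
have NJ y : y \in S -> (N y < J)%N by move=> yS; rewrite ltnS leq_bigmax_seq.
have -> : \sum_(y <- S) p t x0 y * spanR y ^+ 2 =
    \sum_(j < J) j%:R ^+ 2 * \sum_(y <- S | N y == j) p t x0 y.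
  under [RHS]eq_bigr do rewrite big_mkcond mulr_sumr.
  rewrite exchange_big /= !big_seq; apply: eq_bigr => y yS.
  rewrite (bigD1 (Ordinal (NJ y yS)))//= eqxx NE big1 ?addr0;
    first by rewrite mulrC.
  move=> j jN; rewrite ifF ?mulr0//; apply/negbTE; apply: contra jN => /eqP E.
  by apply/eqP/val_inj.
apply: (@le_trans _ _ (\sum_(j < J) C0 * (16 / delta ^+ 2 * q ^+ j)));
  last first.
  rewrite -!mulr_sumr; do 2!apply: ler_wpM2l => //;
    last exact: geometric_sum_le.
  by rewrite divr_ge0 ?sqr_ge0.
apply: ler_sum => j _.
apply: (@le_trans _ _ (j%:R ^+ 2 * (C0 * expR (- (delta * j%:R))))); last first.
  by rewrite mulrCA ler_wpM2l.
apply: ler_wpM2l; first exact: sqr_ge0.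
rewrite -lee_fin; apply: le_trans (tail t j%:R t0 (ler0n _ _)).
apply: le_trans (transition_sum_le_prob S (fun y => N y == j) t uS t0) _.
rewrite le_measure ?inE//.
- exact: (measurable_state mX [set y | N y == j]).
- exact: (measurable_state mX [set y : config n | (j%:R : R) <= (config_span
  y)%:~R]).
- by move=> w /= /eqP E; rewrite -/(spanR _) NE E.
Qed.

Hypothesis pq : has_rates p (Qmatrix m a b).

(** If the condition failed at [k], the mean squared imbalance would gain at least [h * c / 2] in
    every step of a fixed length [h], yet it stays below [B]. *)
Lemma cloud_condition_of_moment (B : R) : 0 <= B -> 0 < activity m a b ->
  (forall t, 0 <= t -> (mean p t x0 (fun x => spanR x ^+ 2)%R <= B%:E)%E) ->
  cloud_condition m a b.
Proof.
move=> B0 act0 HB k kn; rewrite ltNge; apply/negP => hU.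
have [c c0 Hc] := imbalance_sqr_drift hm ha hb k kn hU act0.
have [G G0 HG] := imbalance_sqr_growth (m := m) (a := a) (b := b) hm ha hb k.
have [mu [mu0 _ /(_ _ isT) hmu]] := @finite_positive_lower_bound R 'I_n.+1
  xpredT m (fun i _ => hm i).
have jg := elastic_jump_generator hm ha hb mu mu0 hmu.
set Lam := activity m a b / mu in jg.
have L0 : 0 <= Lam by rewrite divr_ge0// ltW.
pose u (x : config n) := lin (imbalance (m := m) k) x ^+ 2.
have u0 x : 0 <= u x by exact: sqr_ge0.
have uB t : 0 <= t -> (mean p t x0 u <= B%:E)%E.
  move=> t0; apply: le_trans (HB t t0); apply: (le_mean tf) => // x.
  rewrite /u lerXn2r ?nnegrE ?imbalance_ge0 ?spanR_ge0//.
  exact: imbalance_le_span.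
pose LG := Lam * G.
have LG0 : 0 <= LG by rewrite mulr_ge0.
(* The last term makes the second-order loss [h ^+ 2 * LG * (B + 1)] at most half of the gain
   [h * c]; a fixed [h] suffices because the moment is bounded by [B] at all times. *)
pose Den := 1 + Lam + LG + 2 * LG * (B + 1) / c.
have t40 : 0 <= 2 * LG * (B + 1) / c.
  apply: divr_ge0; last exact: ltW.
  by apply: mulr_ge0; [apply: mulr_ge0|apply: addr_ge0].
have Den0 : 0 < Den by rewrite /Den; lra.
pose h := Den^-1.
have h0 : 0 < h by rewrite invr_gt0.
have hD : h * Den = 1 by rewrite mulVf// gt_eqF.
have p1 : 0 <= h * Lam by rewrite mulr_ge0// ltW.
have p2 : 0 <= h * LG by rewrite mulr_ge0// ltW.
have p3 : 0 <= h * (2 * LG * (B + 1) / c) by rewrite mulr_ge0// ltW.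
have hL : h * Lam <= 1 by move: hD; rewrite /Den; lra.
have hLG : h * LG <= 1 by move: hD; rewrite /Den; lra.
have hh : h * LG * (B + 1) <= c / 2.
  have : h * (2 * LG * (B + 1) / c) <= 1 by move: hD; rewrite /Den; lra.
  by rewrite mulrA ler_pdivrMr// mul1r; lra.
have h1 : h <= 1 by move: hD; rewrite /Den; lra.
(* This and the next bound make both coefficients of the affine lower bound [one] nonnegative, so
   that it can be summed against [p]. *)
have hLGh : h ^+ 2 * LG <= 1.
  rewrite expr2 -mulrA; apply: le_trans hLG; rewrite ler_piMl//.
have ch : h ^+ 2 * LG <= h * c.
  rewrite expr2 -mulrA ler_wpM2l ?(ltW h0)//.
  have : 0 <= h * LG * B by rewrite mulr_ge0.
  lra.
have one x : ((u x * (1 - h ^+ 2 * LG) + (h * c - h ^+ 2 * LG))%:E <= mean p h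
  x u)%E.
  apply: le_trans (mean_lower tf pq jg h x u (ltW h0) hL u0); rewrite lee_fin.
  have H1 := ler_wpM2l (ltW h0) (Hc x).
  have L2 : 0 <= h ^+ 2 * Lam by rewrite mulr_ge0 ?sqr_ge0.
  have H2 := ler_wpM2l L2 (HG x).
  rewrite /LG; move: H1 H2; rewrite /drift /u /=; lra.
have grow (j : nat) : ((j%:R * (h * c / 2))%:E <= mean p (j%:R * h) x0 u)%E.
  elim: j => [|j IH]; first by rewrite mul0r mul0r; apply: (mean_ge0 tf).
  have jh : 0 <= j%:R * h by rewrite mulr_ge0// ltW.
  rewrite -natr1 [X in mean p X]mulrDl mul1r (mean_add tf) ?(ltW h0)//.
  apply: (@le_trans _ _ (\esum_(y in setT) ((p (j%:R * h) x0 y)%:E *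
     (u y * (1 - h ^+ 2 * LG) + (h * c - h ^+ 2 * LG))%:E))%E); last first.
    by apply: le_esum => y _; apply: lee_wpmul2l => //;
      rewrite lee_fin (tf_ge0 tf).
  have -> : (\esum_(y in setT) ((p (j%:R * h) x0 y)%:E *
     (u y * (1 - h ^+ 2 * LG) + (h * c - h ^+ 2 * LG))%:E) =
     (1 - h ^+ 2 * LG)%:E * mean p (j%:R * h) x0 u + (h * c - h ^+ 2 *
       LG)%:E)%E.
    rewrite -[X in (_ = _ + X)%E]mule1 -(tf_sum1 tf x0 jh) -!esumZl ?subr_ge0//.
    - rewrite -esumD.
      + by apply: eq_esum => y _; rewrite -!EFinM -EFinD; congr EFin; ring.
      + move=> y _; rewrite -EFinM lee_fin; apply: mulr_ge0;
        first by rewrite subr_ge0.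
        by apply: mulr_ge0 => //; exact: tf_ge0.
      + move=> y _; rewrite -EFinM lee_fin; apply: mulr_ge0;
        first by rewrite subr_ge0.
        exact: tf_ge0.
    - by move=> y; rewrite lee_fin (tf_ge0 tf).
    - by move=> y; rewrite lee_fin mulr_ge0 ?(tf_ge0 tf).
  have := uB _ jh; move: IH; have := mean_ge0 tf _ x0 u jh u0.
  case: mean => [v| |]//; rewrite !lee_fin => v0 IH vB.
  have hL20 : 0 <= h * (h * LG) by rewrite mulr_ge0// ltW.
  have h4 := ler_wpM2l hL20 vB.
  have h5 := ler_wpM2l (ltW h0) hh.
  lra.
have hc2 : 0 < h * c / 2 by rewrite divr_gt0// mulr_gt0.
pose j := (Num.truncn (B / (h * c / 2))).+1.
have : ((j%:R * (h * c / 2))%:E <= B%:E)%E.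
  by apply: (le_trans (grow j)); apply: uB; rewrite mulr_ge0// ltW.
rewrite lee_fin leNgt => /negP; apply.
by rewrite -ltr_pdivrMr// truncnS_gt.
Qed.

End FixedTransition.

Lemma relative_stability_cloud_condition (C delta : R) : 0 <= C -> 0 < delta ->
  0 < activity m a b -> span_tail_bound P x0 X C delta -> cloud_condition m a b.
Proof.
move=> C0 d0 act0 tail; have [p [tf pq fdd]] := mc_fdd el.
have [||B [B0 HB]] := span_second_moment fdd
  (C * (1 + expR (C * (config_span x0)%:~R))) delta _ d0.
- by rewrite mulr_ge0// addr_ge0// expR_ge0.
- move=> t s t0 s0; apply: le_trans (tail s s0).
  by apply: ereal_sup_ubound; exists t.
exact: cloud_condition_of_moment HB.
Qed.

End Necessity.

(* The hypothesis that some jump parameter is nonzero is used only for the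
   necessity of the condition: if all of them vanish and N >= 2, the
   configuration is frozen, so the relative stability (b) holds although the
   condition (0 < 0) fails. *)
Theorem theorem1p3 (R : realType) (n : nat) (m a b : 'I_n.+1 -> R)
    (hm : forall i, 0 < m i) (ha : forall i, 0 <= a i)
    (hb : forall i, 0 <= b i) :
  (cloud_condition m a b ->
     (forall (d : measure_display) (Omega : measurableType d)
        (P : probability Omega R) (x0 : config n) (X : R -> Omega -> config n),
        elastic_system m a b P x0 X ->
        forall i, limiting_speed P X (- (Usum m a b ord_max / Msum m ord_max))
          i)
     /\
     (exists C delta : R, [/\ 0 <= C, 0 < delta &
        forall (d : measure_display) (Omega : measurableType d)
          (P : probability Omega R) (x0 : config n)
          (X : R -> Omega -> config n),
          elastic_system m a b P x0 X -> relative_stability P x0 X C delta]))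
  /\
  ((exists i, a i != 0 \/ b i != 0) ->
     forall (d : measure_display) (Omega : measurableType d)
       (P : probability Omega R) (x0 : config n) (X : R -> Omega -> config n),
       elastic_system m a b P x0 X ->
       (exists C delta : R, [/\ 0 <= C, 0 < delta &
          relative_stability P x0 X C delta]) ->
       cloud_condition m a b).
Proof.
split.
  move=> cc; have [delta [g [K [c [C [[d0 g0 K0 c0 C0] lo up dr]]]]]] :=
    cloud_lyapunov hm ha hb cc.
  split.
    move=> d Omega P x0 X el; apply: (sublinear_limiting_speed hm ha hb el).
    exact: (confined_sublinear hm ha hb el d0 g0 K0 c0 lo dr).
  exists (expR delta + K / g + delta * C), (delta * c); split.
  - by rewrite !addr_ge0 ?expR_ge0 ?divr_ge0 ?mulr_ge0// ltW.
  - exact: mulr_gt0.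
  - move=> d Omega P x0 X el; split.
      exact: (confined_tail_bound hm ha hb el d0 g0 K0 c0 C0 lo up dr).
    exact: (confined_log_growth hm ha hb el d0 g0 K0 c0 lo dr).
move=> [i abi] d Omega P x0 X el [C [delta [C0 d0 [tail _]]]].
apply: (relative_stability_cloud_condition hm ha hb el C delta C0 d0) => //.
(* A nonzero parameter makes its term of [activity] positive. *)
rewrite lt_def activity_ge0// andbT /activity (bigD1 i)//= gt_eqF//.
apply: ltr_pwDl; last by apply: sumr_ge0 => j _;
  rewrite mulr_ge0 ?addr_ge0// ltW.
rewrite mulr_gt0// lt_def addr_ge0// andbT.
by rewrite paddr_eq0// negb_and; apply/orP.
Qed.
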